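(* Let $\mathfrak{H}$ be a separable Hilbert space with an orthogonal decomposition $\mathfrak{H}=\mathfrak{H}_0\oplus\mathfrak{H}_1$, let $A_0$, $A_1$ be bounded self-adjoint operators on $\mathfrak{H}_0$, $\mathfrak{H}_1$ respectively, let $V:\mathfrak{H}_1\to\mathfrak{H}_0$ be a bounded operator, and let $\lambda\in\mathbb{R}$ satisfy $\sup\mathrm{spec}(A_0)\le\lambda\le\inf\mathrm{spec}(A_1)$. Put $$\mathbf{B}=\begin{pmatrix}A_0&V\\ V^*&A_1\end{pmatrix},\qquad \mathfrak{Q}=\mathrm{Ran}\,\mathsf{E}_{\mathbf{B}}((-\infty,\lambda))\oplus\big(\mathrm{Ran}\,\mathsf{E}_{\mathbf{B}}(\{\lambda\})\cap\mathfrak{H}_0\big),$$ and let $X:\mathfrak{H}_0\to\mathfrak{H}_1$ be the contractive solution to the Riccati equation $$A_1X-XA_0-XVX+V^*=0$$ with $\mathcal{G}(\mathfrak{H}_0,X)=\mathfrak{Q}$. Let $$\mathfrak{K}_0=\mathrm{closure}\big\{x\in\mathrm{Ker}(A_0-\lambda)\cap\mathrm{Ran}\,V\ \big|\ V^*(VV^* )^nx\in\mathrm{Ker}(A_1-\lambda),\ (VV^* )^nx\in\mathrm{Ker}(A_0-\lambda)\ \forall n\in\mathbb{N}_0\big\},$$ $$\mathfrak{K}_1=\mathrm{closure}\big\{x\in\mathrm{Ker}(A_1-\lambda)\cap\mathrm{Ran}\,V^*\ \big|\ V(V^*V)^nx\in\mathrm{Ker}(A_0-\lambda),\ (V^*V)^nx\in\mathrm{Ker}(A_1-\lambda)\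 \forall n\in\mathbb{N}_0\big\}.$$ Then $X$ is the unique contractive solution to the Riccati equation if and only if both of the following hold: (i) either $\mathrm{Ker}(A_0-\lambda)\cap\mathrm{Ker}\,V^*$ or $\mathrm{Ker}(A_1-\lambda)\cap\mathrm{Ker}\,V$ is trivial; (ii) either $\mathfrak{K}_0$ or $\mathfrak{K}_1$ (and hence both) is trivial. In this case the solution $X$ is strictly contractive.
   Context: $\mathrm{spec}(T)$ denotes the spectrum of $T$, $\mathsf{E}_{\mathbf{B}}(\Delta)$ the spectral projection of the self-adjoint operator $\mathbf{B}$ for the Borel set $\Delta\subset\mathbb{R}$, and $\mathbb{N}_0=\{0,1,2,\dots\}$. The graph of $X$ is $\mathcal{G}(\mathfrak{H}_0,X)=\{x\oplus Xx\mid x\in\mathfrak{H}_0\}$. Under the stated hypotheses it is known that $\mathfrak{Q}$ is the graph of a (necessarily unique) operator $X$ with $\|X\|\le1$ and that this $X$ solves the Riccati equation. A contractive solution is a bounded operator $\mathfrak{H}_0\to\mathfrak{H}_1$ of norm at most $1$ satisfying the Riccati equation. $X$ is strictly contractive if $\|Xf\|<\|f\|$ for all $f\neq0$. *)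

(* Defs.v *)
From HB Require Import structures.
From mathcomp Require Import all_boot all_order all_algebra.
From mathcomp Require Import sesquilinear complex.
From mathcomp Require Import all_classical all_reals all_analysis.

Set Implicit Arguments.
Unset Strict Implicit.
Unset Printing Implicit Defensive.

Import Order.TTheory GRing.Theory Num.Theory.
Import numFieldNormedType.Exports.

Local Open Scope classical_set_scope.
Local Open Scope ring_scope.
Local Open Scope complex_scope.

(* Complex Hilbert spaces. The inner product is linear in its first argument
   and conjugate-linear in its second one; norms take values in R[i]. *)
HB.mixin Record CompleteNormedModule_isHilbert (R : realType) H
    of CompleteNormedModule R[i] H := {
  inner : {dot H for @Num.conj R[i]} ;
  inner_norm : forall x : H, inner x x = `|x| ^+ 2
}.

#[short(type="hilbertType")]
HB.structure Definition Hilbert (R : realType) :=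
  {H of CompleteNormedModule_isHilbert R H & CompleteNormedModule R[i] H}.

Definition separable (T : topologicalType) : Prop :=
  exists D : set T, countable D /\ dense D.

Section operators.
Context (R : realType).

Definition bounded_operator (H K : hilbertType R) (T : H -> K) : Prop :=
  exists M : R, forall x, `|T x| <= M%:C * `|x|.

Definition is_adjoint (H K : hilbertType R) (T : H -> K) (Ts : K -> H) : Prop :=
  forall x y, inner (T x) y = inner x (Ts y).

Definition self_adjoint (H : hilbertType R) (T : H -> H) : Prop :=
  is_adjoint T T.

Definition ker (H K : hilbertType R) (T : H -> K) : set H :=
  [set x | T x = 0].

Definition shift_op (H : hilbertType R) (T : H -> H) (z : R[i]) : H -> H :=
  fun x => T x - z *: x.

Definition spectrum (H : hilbertType R) (T : H -> H) : set R[i] :=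
  [set z | ~ exists S : {linear H -> H},
     [/\ bounded_operator S, cancel (shift_op T z) S
       & cancel S (shift_op T z)]].

(* For self-adjoint T the spectrum is contained in the real line, so this is
   the whole of it. Bounds on it are taken in \bar R because it is empty when
   H is the zero space. *)
Definition real_spectrum (H : hilbertType R) (T : H -> H) : set R :=
  [set t | spectrum T t%:C].

(* E is the projection-valued measure on the Borel sets of the real line with
   T = \int t dE(t); by the spectral theorem every bounded self-adjoint T has
   exactly one (up to its irrelevant values at non-measurable sets). The
   integral is understood weakly, through the measures D |-> <E(D) x, x>; by
   polarization these diagonal values determine T. *)
Record is_spectral_measure (H : hilbertType R) (T : H -> H)
    (E : set R -> {linear H -> H}) : Prop := {
  spectral_idem : forall D, measurable D -> forall x, E D (E D x) = E D x ;
  spectral_self_adjoint : forall D, measurable D -> self_adjoint (E D) ;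
  spectral_setT : forall x, E setT x = x ;
  spectral_setI : forall D1 D2, measurable D1 -> measurable D2 ->
    forall x, E (D1 `&` D2) x = E D1 (E D2 x) ;
  spectral_sigma_additive : forall F : nat -> set R,
    (forall n, measurable (F n)) -> trivIset setT F ->
    forall x, series (fun n => E (F n) x) @ \oo --> E (\bigcup_n F n) x ;
  spectral_integral : forall x,
    exists mu : {measure set (measurableTypeR R) -> \bar R},
      [/\ forall D : set R, measurable D ->
            mu D = (complex.Re (inner (E D x) x))%:E,
          mu.-integrable setT (fun t : R => t%:E)
        & inner (T x) x = (\int[mu]_(t in setT) t)%:C]
}.

End operators.

Section decomposition.
Context (R : realType) (H H0 H1 : hilbertType R).
Variables (J0 : {linear H0 -> H}) (J1 : {linear H1 -> H}).

(* H = H0 (+) H1: the isometries J0 and J1 identify H0 and H1 with mutually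
   orthogonal subspaces of H that together span H. *)
Record orthogonal_decomposition : Prop := {
  isometry0 : forall x y, inner (J0 x) (J0 y) = inner x y ;
  isometry1 : forall x y, inner (J1 x) (J1 y) = inner x y ;
  orthogonal01 : forall x y, inner (J0 x) (J1 y) = 0 ;
  span01 : forall h, exists x y, h = J0 x + J1 y
}.

Definition is_block_operator (A0 : H0 -> H0) (V : H1 -> H0) (Vs : H0 -> H1)
    (A1 : H1 -> H1) (B : H -> H) : Prop :=
  forall x y, B (J0 x + J1 y) = J0 (A0 x + V y) + J1 (Vs x + A1 y).

Definition graph (X : H0 -> H1) : set H := range (fun x => J0 x + J1 (X x)).

Definition spectral_subspace (E : set R -> {linear H -> H}) (lam : R) : set H :=
  [set u + v | u in range (E `]-oo, lam[%classic)
             & v in range (E [set lam]) `&` range J0].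

End decomposition.

Section riccati.
Context (R : realType) (H0 H1 : hilbertType R).

Definition riccati (A0 : H0 -> H0) (A1 : H1 -> H1) (V : H1 -> H0)
    (Vs : H0 -> H1) (X : H0 -> H1) : Prop :=
  forall x, A1 (X x) - X (A0 x) - X (V (X x)) + Vs x = 0.

Definition contractive_solution (A0 : H0 -> H0) (A1 : H1 -> H1) (V : H1 -> H0)
    (Vs : H0 -> H1) (X : {linear H0 -> H1}) : Prop :=
  (forall x, `|X x| <= `|x|) /\ riccati A0 A1 V Vs X.

Definition strictly_contractive (X : H0 -> H1) : Prop :=
  forall f, f != 0 -> `|X f| < `|f|.

(* This is K_0; the space K_1 is obtained by exchanging the roles of the
   indices 0 and 1 and of V and V^*. *)
Definition invariant_kernel (A0 : H0 -> H0) (A1 : H1 -> H1) (V : H1 -> H0)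
    (Vs : H0 -> H1) (lam : R) : set H0 :=
  closure [set x | [/\ ker (shift_op A0 lam%:C) x, range V x
    & forall n, ker (shift_op A1 lam%:C) (Vs (iter n (V \o Vs) x)) /\
                ker (shift_op A0 lam%:C) (iter n (V \o Vs) x)]].

End riccati.

(* Main.v *)
Require Import Defs.
From HB Require Import structures.
From mathcomp Require Import all_boot all_order all_algebra.
From mathcomp Require Import sesquilinear complex.
From mathcomp Require Import all_classical all_reals all_analysis.
From mathcomp Require Import ring lra.

Set Implicit Arguments.
Unset Strict Implicit.
Unset Printing Implicit Defensive.

Import Order.TTheory GRing.Theory Num.Theory.
Import numFieldNormedType.Exports.

Local Open Scope classical_set_scope.
Local Open Scope ring_scope.
Local Open Scope complex_scope.

(** Write T = B - lam, let H_-, N and H_+ be the spectral subspaces of T for the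
negative half-line, the point 0 and the positive half-line, and let j be the indefinite
form of the symmetry J = diag(1, -1). On a nonzero space the supremum of the numerical
range of a bounded self-adjoint operator lies in the spectrum
([numerical_sup_in_spectrum]), so the bounds on the spectra give A_0 <= lam <= A_1 as
forms. Hence the real part of <Tu, Ju> is nonpositive for every u ([derivative_le0]).

The graph L of a contractive solution is a closed T-invariant subspace on which j is
nonnegative; on its orthogonal complement, also T-invariant, j is nonpositive. Scale T
to a contraction. A vector u of L in H_+ satisfies (1 - T)^n u -> 0, while j does not
decrease along this sequence, so j(u) = 0 ([decays_form_eq0]). Then u is isotropic in L,
that is j-orthogonal to all of L, and on isotropic vectors the diagonal blocks A_0 - lam
and A_1 - lam vanish, so that T acts through V and V^* alone and keeps vectors isotropic
([isotropic_step]). Iterating puts the components of Tu into the spaces K_0 and K_1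
([isotropic_core]); one of these is trivial exactly when the other is, because V and V^*
map their defining sets injectively into each other ([kernel_core_trivial_swap]).
Hence, when they are trivial, isotropic vectors lie in the kernel N of T, the graph
meets H_+ trivially and its complement meets H_- trivially, and H_- <= L <= H_- + N.
Finally N is the direct sum of N_0 = Ker(A_0 - lam) /\ Ker V^* and
N_1 = Ker(A_1 - lam) /\ Ker V. If N_0 is trivial then L = H_- ([graph_eq_neg]); if N_1
is trivial then L = H_- + N ([graph_eq_nonpos]); either way L does not depend on the
solution ([solution_unique]). A vector x with |Xx| = |x| gives an isotropic vector of
the graph, hence nonzero vectors x of N_0 and Xx of N_1 if x is nonzero
([isometric_kernel]): this is strict contractivity.

Conversely, suppose that a condition fails. If N_0 and N_1 contain unit vectors a and b,
then X vanishes at a and has range orthogonal to b, and adding the rank-one map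
<., a> b to X gives another contractive solution ([rank_one_solution]). If K_0 is
nontrivial, then X maps K_0 into K_1 and the complement of K_0 into the complement of
K_1, and changing the sign of X on K_0 gives another contractive solution
([reflected_solution]). The mapping properties hold because K_0 + K_1 reduces T and
hence the spectral subspaces. No functional calculus enters: H_+ is exactly the set of
vectors with (1 - T)^n u -> 0, and similarly for H_- and -T ([spectral_posP],
[spectral_negP]), a description that any reducing subspace respects ([decays_split]).

Orthogonality and estimates are phrased with the real part of the inner product: it
makes every form symmetric and real-valued, and real orthogonality to a complex subspace
is the same as complex orthogonality. *)

(** * The real part of the inner product *)

Section real_form.
Context (R : realType).
Implicit Types H : hilbertType R.

Definition ip H (x y : H) : R := complex.Re (inner x y).

Definition sq H (x : H) : R := ip x x.

Lemma Re_conj (c : R[i]) : complex.Re (Num.conj c) = complex.Re c.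
Proof. by case: c. Qed.

Lemma ReD (a b : R[i]) : complex.Re (a + b) = complex.Re a + complex.Re b.
Proof. by case: a b => [? ?] [? ?]. Qed.

Lemma ReN (a : R[i]) : complex.Re (- a) = - complex.Re a.
Proof. by case: a. Qed.

Lemma innerC H (x y : H) : inner x y = Num.conj (inner y x).
Proof. by rewrite hermC /= expr0 mul1r. Qed.

Lemma ipC H (x y : H) : ip x y = ip y x.
Proof. by rewrite /ip innerC Re_conj. Qed.

Lemma ipDl H (x y z : H) : ip (x + y) z = ip x z + ip y z.
Proof. by rewrite /ip linearDl ReD. Qed.

Lemma ipDr H (x y z : H) : ip z (x + y) = ip z x + ip z y.
Proof. by rewrite ipC ipDl !(ipC z). Qed.

Lemma ipNl H (x z : H) : ip (- x) z = - ip x z.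
Proof. by rewrite /ip linearNl ReN. Qed.

Lemma ipNr H (x z : H) : ip z (- x) = - ip z x.
Proof. by rewrite ipC ipNl ipC. Qed.

Lemma ipBl H (x y z : H) : ip (x - y) z = ip x z - ip y z.
Proof. by rewrite ipDl ipNl. Qed.

Lemma ipBr H (x y z : H) : ip z (x - y) = ip z x - ip z y.
Proof. by rewrite ipDr ipNr. Qed.

Lemma ip0l H (z : H) : ip 0 z = 0.
Proof. by rewrite /ip linear0l. Qed.

Lemma ip0r H (z : H) : ip z 0 = 0.
Proof. by rewrite ipC ip0l. Qed.

(** Replaces complex homogeneity, which the real part does not have. *)
Lemma ip_conj H (c : R[i]) (x y : H) : ip (c *: x) y = ip x (Num.conj c *: y).
Proof. by rewrite /ip linearZl_LR linearZr_LR /= conjCK. Qed.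

Lemma ipZl H (a : R) (x y : H) : ip (a%:C *: x) y = a * ip x y.
Proof.
rewrite /ip linearZl_LR /=; case: (inner x y) => p q /=.
by rewrite mul0r subr0.
Qed.

Lemma ipZr H (a : R) (x y : H) : ip y (a%:C *: x) = a * ip y x.
Proof. by rewrite ipC ipZl ipC. Qed.

Definition ipE := (ipDl, ipDr, ipBl, ipBr, ipNl, ipNr, ipZl, ipZr, ip0l, ip0r).

Lemma normE H (x : H) : `|x| = (complex.Re `|x|)%:C.
Proof. by rewrite RRe_real ?normr_real. Qed.

Lemma sqE H (x : H) : sq x = complex.Re `|x| ^+ 2.
Proof. by rewrite /sq /ip inner_norm normE /= !expr2 /= mulr0 subr0. Qed.

Lemma sq_ge0 H (x : H) : 0 <= sq x.
Proof. by rewrite sqE sqr_ge0. Qed.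

Lemma sq_eq0 H (x : H) : sq x = 0 -> x = 0.
Proof.
move=> /eqP; rewrite sqE sqrf_eq0 => /eqP x0.
by apply/eqP; rewrite -normr_eq0 normE x0.
Qed.

Lemma sq_le0 H (x : H) : sq x <= 0 -> x = 0.
Proof. by move=> x0; apply/sq_eq0/eqP; rewrite eq_le x0 sq_ge0. Qed.

Lemma sq0 H : sq (0 : H) = 0.
Proof. by rewrite /sq ip0l. Qed.

Lemma ip_ext H (x y : H) : (forall z, ip x z = ip y z) -> x = y.
Proof.
move=> xy; apply/eqP; rewrite -subr_eq0; apply/eqP/sq_eq0.
by rewrite {1}/sq ipBl xy subrr.
Qed.

Lemma sqD H (x y : H) : sq (x + y) = sq x + 2 * ip x y + sq y.
Proof. rewrite /sq !ipE (ipC y x); ring. Qed.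

Lemma sqB H (x y : H) : sq (x - y) = sq x - 2 * ip x y + sq y.
Proof. rewrite /sq !ipE (ipC y x); ring. Qed.

Lemma sqN H (x : H) : sq (- x) = sq x.
Proof. by rewrite /sq !ipE opprK. Qed.

Lemma sqBC H (x y : H) : sq (x - y) = sq (y - x).
Proof. by rewrite -sqN opprB. Qed.

Lemma sqZ H (a : R) (x : H) : sq (a%:C *: x) = a ^+ 2 * sq x.
Proof. rewrite /sq !ipE; ring. Qed.

Lemma conj_real (a : R) : Num.conj a%:C = a%:C.
Proof. by apply/eqP; rewrite eq_complex /= oppr0 !eqxx. Qed.

Lemma inner_sq H (x : H) : inner x x = (sq x)%:C.
Proof. by rewrite sqE inner_norm {1}normE rmorphXn. Qed.

Lemma sqZ_complex H (c : R[i]) (x : H) :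
  sq (c *: x) = complex.Re (c * Num.conj c) * sq x.
Proof.
rewrite /sq ip_conj scalerA mulrC -ipZr RRe_real// -normCK rpredX//.
exact: normr_real.
Qed.

Lemma Re_mul_conj_ge0 (c : R[i]) : 0 <= complex.Re (c * Num.conj c).
Proof. by have := mul_conjC_ge0 c; rewrite lecE /= => /andP[]. Qed.

Lemma sqD_le H (x y : H) : sq (x + y) <= 2 * sq x + 2 * sq y.
Proof. have := sq_ge0 (x - y); rewrite sqB sqD; lra. Qed.

(** The source of every Cauchy--Schwarz inequality below, for inner products as well as
for semidefinite and indefinite forms. *)
Lemma discriminant_le (a b c : R) : 0 <= c ->
  (forall t, 0 <= a + 2 * t * b + t ^+ 2 * c) -> b ^+ 2 <= a * c.
Proof.
rewrite le_eqVlt => /orP[/eqP<-|c0] h.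
  rewrite mulr0; have [->|b0] := eqVneq b 0; first by rewrite expr0n.
  have := h (- (a + 1) / (2 * b)); rewrite mulr0 addr0.
  have -> : a + 2 * (- (a + 1) / (2 * b)) * b = -1 by field.
  by rewrite ler0N1.
have cb := h (- b / c).
have -> : b ^+ 2 = (b ^+ 2 / c) * c by field; rewrite gt_eqF.
apply: ler_wpM2r; first exact: ltW.
rewrite -subr_ge0.
suff -> : a - b ^+ 2 / c = a + 2 * (- b / c) * b + (- b / c) ^+ 2 * c by [].
by field; rewrite gt_eqF.
Qed.

Lemma ip_sqr_le H (x y : H) : ip x y ^+ 2 <= sq x * sq y.
Proof.
apply: discriminant_le (sq_ge0 y) _ => t.
have := sq_ge0 (x + t%:C *: y).
by rewrite sqD sqZ ipZr mulrA.
Qed.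

Lemma abs_ip_le H (x y : H) (c : R) :
  0 <= c -> sq x * sq y <= c ^+ 2 -> `|ip x y| <= c.
Proof.
move=> c0 h; rewrite -(ger0_norm c0) -ler_sqr ?nnegrE// !real_normK ?num_real//.
exact: le_trans (ip_sqr_le x y) h.
Qed.

End real_form.

(** * Completeness and orthogonal projection *)

Section topology.
Context (R : realType) (H : hilbertType R).
Implicit Types x y z : H.

Lemma norm_lt_sq x (r : R) : 0 < r -> (`|x| < r%:C) = (sq x < r ^+ 2).
Proof.
move=> r0; have n0 : 0 <= complex.Re `|x|.
  by have := normr_ge0 x; rewrite normE lecE /= => /andP[].
by rewrite normE ltcE /= eqxx sqE ltr_sqr ?nnegrE// ltW.
Qed.

Lemma norm_le_sq (K : hilbertType R) x (y : K) : (`|y| <= `|x|) = (sq y <= sq x).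
Proof.
have n0 (L : hilbertType R) (z : L) : 0 <= complex.Re `|z|.
  by have := normr_ge0 z; rewrite normE lecE /= => /andP[].
by rewrite (normE y) (normE x) lecE /= eqxx !sqE ler_sqr ?nnegrE.
Qed.

Lemma gt0_complex (e : R[i]) : 0 < e -> exists2 r : R, 0 < r & e = r%:C.
Proof. by case: e => a b; rewrite ltcE /= => /andP[/eqP-> a0]; exists a. Qed.

(** Completeness in a form free of filters and of the complex-valued norm. *)
Lemma sq_complete (u : nat -> H) :
  (forall e : R, 0 < e -> exists N, forall n m,
     (N <= n)%N -> (N <= m)%N -> sq (u n - u m) < e) ->
  exists l, forall e : R, 0 < e -> exists N, forall n, (N <= n)%N ->
    sq (u n - l) < e.
Proof.
move=> hu.
have /cvg_ex[l ul] : cvg (u @ \oo).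
  apply/cauchy_cvgP/cauchy_exP => _ /gt0_complex[r r0 ->].
  have [N hN] := hu (r ^+ 2) (exprn_gt0 _ r0).
  exists (u N); exists N => // n /= Nn.
  by rewrite -ball_normE /ball_ /= norm_lt_sq// hN.
exists l => e e0; have s0 : 0 < Num.sqrt e by rewrite sqrtr_gt0.
have s0' : 0 < (Num.sqrt e)%:C by rewrite ltcE /= eqxx.
have /cvgrPdist_lt/(_ _ s0')[N _ hN] := ul.
exists N => n /hN.
by rewrite /= norm_lt_sq// sqr_sqrtr ?ltW// sqBC.
Qed.

Lemma closure_sq (D : set H) x :
  closure D x <-> forall e : R, 0 < e -> exists2 y, D y & sq (x - y) < e.
Proof.
split=> [Dx e e0|h B].
  have s0 : 0 < Num.sqrt e by rewrite sqrtr_gt0.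
  have s0' : 0 < (Num.sqrt e)%:C by rewrite ltcE /= eqxx.
  have [y [Dy]] := Dx _ (nbhsx_ballx x _ s0').
  rewrite -ball_normE /ball_ /= norm_lt_sq// sqr_sqrtr ?ltW// => xy.
  by exists y.
move=> /nbhs_ballP[_ /= /gt0_complex[r r0 ->] xB].
have [y Dy xy] := h (r ^+ 2) (exprn_gt0 _ r0).
exists y; split => //; apply: xB.
by rewrite -ball_normE /ball_ /= norm_lt_sq.
Qed.

Lemma sq_arbitrarily_small x : (forall e : R, 0 < e -> sq x < e) -> x = 0.
Proof.
move=> h; apply: sq_le0; apply/ler_addgt0Pl => e e0.
by rewrite addr0 ltW ?h.
Qed.

(** Closedness is phrased by approximation, the form in which it is proved for graphs
and used for limits of minimizing sequences. *)
Record closed_subspace (S : set H) : Prop := {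
  subspace0 : S 0 ;
  subspaceD : forall x y, S x -> S y -> S (x + y) ;
  subspaceZ : forall c x, S x -> S (c *: x) ;
  subspace_closed : forall x,
    (forall e : R, 0 < e -> exists2 y, S y & sq (x - y) < e) -> S x }.

Definition orthogonal (S : set H) : set H := [set x | forall y, S y -> ip x y = 0].

Lemma subspaceN S x : closed_subspace S -> S x -> S (- x).
Proof. by move=> hS Sx; rewrite -scaleN1r; apply: subspaceZ. Qed.

Lemma subspaceB S x y : closed_subspace S -> S x -> S y -> S (x - y).
Proof. by move=> hS Sx Sy; apply: subspaceD => //; apply: subspaceN. Qed.

Lemma closure_subspace (D : set H) : D 0 ->
  (forall x y, D x -> D y -> D (x + y)) -> (forall c x, D x -> D (c *: x)) ->
  closed_subspace (closure D).
Proof.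
move=> D0 DD DZ; split.
- exact: subset_closure.
- move=> x y /closure_sq hx /closure_sq hy; apply/closure_sq => e e0.
  have e4 : 0 < e / 4 by rewrite divr_gt0.
  have [a Da xa] := hx _ e4; have [b Db yb] := hy _ e4.
  exists (a + b); first exact: DD.
  rewrite opprD addrACA; have := sqD_le (x - a) (y - b); lra.
- move=> c x /closure_sq hx; apply/closure_sq => e e0.
  have k0 := Re_mul_conj_ge0 c; set k : R := complex.Re _ in k0.
  have [a Da xa] := hx (e / (k + 1)) (divr_gt0 e0 (ltr_wpDl k0 ltr01)).
  exists (c *: a); first exact: DZ.
  rewrite -scalerBr sqZ_complex -/k.
  have := sq_ge0 (x - a); move: xa; rewrite ltr_pdivlMr ?ltr_wpDl//; nra.
- move=> x hx; apply/closure_sq => e e0.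
  have e4 : 0 < e / 4 by rewrite divr_gt0.
  have [a /closure_sq/(_ _ e4)[b Db ab] xa] := hx _ e4.
  exists b => //; rewrite -[x - b](subrKA a).
  have := sqD_le (x - a) (a - b); lra.
Qed.

(** A minimizing sequence for the distance to a closed subspace is Cauchy, by the
parallelogram law; its limit is the foot of the perpendicular. *)
Lemma orthogonal_projection (S : set H) x : closed_subspace S ->
  exists2 p, S p & orthogonal S (x - p).
Proof.
move=> hS; pose A := [set sq (x - y) | y in S].
have A0 : A !=set0 by exists (sq (x - 0)), 0 => //; exact: subspace0.
have lA : has_lbound A by exists 0 => _ [y _ <-]; exact: sq_ge0.
have infA : has_inf A by split.
set d := inf A.
have dle y : S y -> d <= sq (x - y) by move=> Sy; apply: ge_inf => //; exists y.
have hy n : exists y, S y /\ sq (x - y) < d + n.+1%:R^-1.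
  have n0 : 0 < n.+1%:R^-1 :> R by rewrite invr_gt0.
  by have [_ [y Sy <-] ylt] := inf_adherent n0 infA; exists y.
have [y /all_and2[Sy ylt]] := choice hy.
have small (e : R) : 0 < e -> exists N, forall n, (N <= n)%N -> n.+1%:R^-1 < e.
  move=> e0; exists (Num.truncn e^-1) => n Nn.
  rewrite -[e]invrK ltf_pV2 ?posrE ?invr_gt0//.
  by apply: lt_le_trans (truncnS_gt _) _; rewrite ler_nat.
have [p hp] : exists p, forall e : R, 0 < e -> exists N, forall n, (N <= n)%N ->
    sq (y n - p) < e.
  apply: sq_complete => e e0.
  have [N hN] := small (e / 4) ltac:(by rewrite divr_gt0).
  exists N => n m /hN Nn /hN Nm.
  have Smid : S ((2^-1)%:C *: (y n + y m)).
    by apply: (subspaceZ hS); apply: (subspaceD hS).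
  have := dle _ Smid; have := ylt n; have := ylt m.
  have -> : y n - y m = (x - y m) - (x - y n) by rewrite opprB [RHS]addrC subrKA.
  set a := x - y m; set b := x - y n.
  have -> : x - (2^-1)%:C *: (y n + y m) = (2^-1)%:C *: (a + b).
    have half : x = (2^-1)%:C *: (x + x).
      rewrite scalerDr -scalerDl -rmorphD /=.
      have -> : (2^-1 + 2^-1 = 1 :> R) by field.
      by rewrite rmorph1 scale1r.
    by rewrite {1}half -scalerBr /a /b addrACA -opprD (addrC (y m)).
  have -> : e = e / 4 * 4 by field.
  move: a b => a b; rewrite sqZ sqD sqB; move: Nn Nm.
  set r := n.+1%:R^-1; set r' := m.+1%:R^-1; move: r r' => r r'.
  have -> : (2^-1 : R) ^+ 2 = 4^-1 by field.
  lra.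
have Sp : S p.
  apply: subspace_closed => // e /hp[n pn]; exists (y n) => //.
  by rewrite sqBC pn.
exists p => // z Sz; apply/eqP; rewrite -sqrf_eq0 eq_le sqr_ge0 andbT.
apply/ler_addgt0Pl => e e0; rewrite addr0.
have z0 := sq_ge0 z.
set c := e / (4 * (sq z + 1)).
have c0 : 0 < c by rewrite divr_gt0// mulr_gt0// ltr_wpDl.
have cE : c * sq z <= e / 4.
  have -> : e / 4 = c * (sq z + 1) by rewrite /c; field; rewrite gt_eqF// ltr_wpDl.
  by rewrite ler_pM2l// lerDl.
have [N1 h1] := hp c c0; have [N2 h2] := small c c0.
set n := maxn N1 N2.
have yp := h1 n (leq_maxl _ _); have yx := h2 n (leq_maxr _ _).
(* y n is nearly the closest point, so x - y n is nearly orthogonal to z *)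
have xy : ip (x - y n) z ^+ 2 <= c * sq z.
  have : ip (x - y n) z ^+ 2 <= (sq (x - y n) - d) * sq z.
    apply: discriminant_le => // t.
    have := dle (y n - t%:C *: z) (subspaceB hS (Sy n) (subspaceZ hS _ Sz)).
    have -> : x - (y n - t%:C *: z) = (x - y n) + t%:C *: z.
      by rewrite opprB addrCA addrC.
    rewrite sqD sqZ ipZr; lra.
  move/le_trans; apply; rewrite ler_wpM2r//.
  by rewrite lerBlDl ltW// (lt_trans (ylt n))// ltrD2l.
have yz := ip_sqr_le (y n - p) z.
have -> : x - p = (x - y n) + (y n - p) by rewrite addrA subrK.
rewrite ipDl.
have ypz : sq (y n - p) * sq z <= c * sq z by rewrite ler_wpM2r// ltW.
move: (ip (x - y n) z) (ip (y n - p) z) xy yz => a b xy yz.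
have -> : (a + b) ^+ 2 = 2 * a ^+ 2 + 2 * b ^+ 2 - (a - b) ^+ 2 by ring.
have ab := sqr_ge0 (a - b).
have {yz} yz := le_trans yz ypz.
move: (a ^+ 2) (b ^+ 2) ((a - b) ^+ 2) (c * sq z) xy yz ab cE => *; lra.
Qed.

Lemma orthogonal_closed_subspace (S : set H) :
  closed_subspace S -> closed_subspace (orthogonal S).
Proof.
move=> hS; split.
- by move=> z _; rewrite ip0l.
- by move=> x y hx hy z Sz; rewrite ipDl hx// hy// addr0.
- by move=> c x hx z Sz; rewrite ip_conj hx//; apply: subspaceZ.
move=> x hx z Sz; apply/eqP; rewrite -sqrf_eq0 eq_le sqr_ge0 andbT.
apply/ler_addgt0Pl => e e0; rewrite addr0.
have z1 : 0 < sq z + 1 by rewrite ltr_wpDl// sq_ge0.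
have [y hy xy] := hx _ (divr_gt0 e0 z1).
have -> : ip x z = ip (x - y) z by rewrite ipBl hy// subr0.
apply: le_trans (ip_sqr_le _ _) _; move: xy; rewrite ltr_pdivlMr//.
have := sq_ge0 (x - y); lra.
Qed.

Lemma subspace_decomp (S : set H) x : closed_subspace S ->
  exists p q, [/\ S p, orthogonal S q & x = p + q].
Proof.
move=> hS; have [p Sp xp] := orthogonal_projection x hS.
by exists p, (x - p); split => //; rewrite addrC subrK.
Qed.

Lemma subspace_meet_orthogonal (S : set H) x : S x -> orthogonal S x -> x = 0.
Proof. by move=> Sx /(_ _ Sx)/sq_eq0. Qed.

Lemma linear_projection (S : set H) : closed_subspace S ->
  exists P : {linear H -> H}, forall x,
    (S x -> P x = x) /\ (orthogonal S x -> P x = 0).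
Proof.
move=> hS; have hS' := orthogonal_closed_subspace hS.
have /choice[P hP] : forall x, exists p, S p /\ orthogonal S (x - p).
  by move=> x; have [p Sp xp] := orthogonal_projection x hS; exists p.
have Pu x p : S p -> orthogonal S (x - p) -> P x = p.
  move=> Sp xp; have [SPx xPx] := hP x.
  apply/eqP; rewrite -subr_eq0; apply/eqP/(@subspace_meet_orthogonal S).
    exact: (subspaceB hS).
  have -> : P x - p = (x - p) - (x - P x) by rewrite opprB [RHS]addrC subrKA.
  exact: (subspaceB hS').
have Plin : linear P.
  move=> c x y; have [SPx xPx] := hP x; have [SPy yPy] := hP y.
  apply: Pu; first by apply: (subspaceD hS) => //; apply: (subspaceZ hS).
  rewrite opprD addrACA -scalerBr.
  by apply: (subspaceD hS') => //; apply: (subspaceZ hS').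
pose Pl : {linear H -> H} := HB.pack P (GRing.isLinear.Build R[i] H H *:%R P Plin).
exists Pl => x; split=> hx /=; apply: Pu => //.
- by rewrite subrr; exact: (subspace0 hS').
- exact: (subspace0 hS).
- by rewrite subr0.
Qed.

End topology.

(** * Damped iterations of a symmetric contraction *)

Section damping.
Context (R : realType) (H : hilbertType R).
Implicit Types (T P Q : {linear H -> H}) (L : set H).

Definition symmetric_op (T : H -> H) := forall x y, ip (T x) y = ip x (T y).

Definition damp (T : H -> H) (x : H) : H := x - T x.

(** The infimum of the orbit norms is zero. Asking this instead of convergence of the
orbit to zero loses nothing for the operators considered here, and is enough to exclude
every component on which the damping is not contracting. *)
Definition decays (T : H -> H) (u : H) : Prop :=
  forall e : R, 0 < e -> exists n, sq (iter n (damp T) u) < e.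

Lemma iter_dampD T n x y :
  iter n (damp T) (x + y) = iter n (damp T) x + iter n (damp T) y.
Proof. by elim: n => //= n ->; rewrite /damp linearD opprD addrACA. Qed.

Lemma iter_damp_sym T n x y : symmetric_op T ->
  ip (iter n (damp T) x) y = ip x (iter n (damp T) y).
Proof.
move=> sT; elim: n x y => //= n IH x y.
by rewrite -[in RHS]iterS iterSr -IH /damp !ipE sT.
Qed.

Lemma iter_damp_comm T Q n x : (forall y, T (Q y) = Q (T y)) ->
  iter n (damp T) (Q x) = Q (iter n (damp T) x).
Proof. by move=> TQ; elim: n => //= n ->; rewrite /damp TQ linearB. Qed.

Lemma iter_damp_in T L n x : closed_subspace L -> (forall y, L y -> L (T y)) ->
  L x -> L (iter n (damp T) x).
Proof.
by move=> hL TL Lx; elim: n => //= n IH; apply: subspaceB => //; apply: TL.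
Qed.

Lemma symmetric_form_sqr_le T x y : symmetric_op T ->
  (forall s : R, 0 <= ip (T (x + s%:C *: y)) (x + s%:C *: y)) ->
  0 <= ip (T y) y -> ip (T x) y ^+ 2 <= ip (T x) x * ip (T y) y.
Proof.
move=> sT h y0; apply: discriminant_le => // s.
have := h s; rewrite linearD linearZ /= !ipE (sT y) (ipC y).
by congr (_ <= _); ring.
Qed.

Lemma projection_sq_le P x : symmetric_op P -> (forall y, P (P y) = P y) ->
  sq (P x) <= sq x.
Proof.
move=> sP PP; have := sq_ge0 (x - P x); rewrite sqB.
have -> : ip x (P x) = sq (P x) by rewrite /sq sP PP.
by lra.
Qed.

(** On the range of [P] one has T^2 <= T: apply Cauchy--Schwarz for the semidefinite
form of [T] to v and Tv. *)
Lemma positive_contraction_sq_le T P v :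
  symmetric_op T -> (forall x, sq (T x) <= sq x) ->
  (forall x, T (P x) = P (T x)) ->
  (forall u, P u = u -> 0 <= ip (T u) u) -> P v = v ->
  sq (T v) <= ip (T v) v.
Proof.
move=> sT cT TP pos Pv.
have PTv : P (T v) = T v by rewrite -TP Pv.
have /(symmetric_form_sqr_le sT) : forall s : R,
    0 <= ip (T (v + s%:C *: T v)) (v + s%:C *: T v).
  by move=> s; apply: pos; rewrite linearD linearZ /= Pv PTv.
move=> /(_ (pos _ PTv)).
have h : ip (T (T v)) (T v) <= sq (T v).
  apply: le_trans (ler_norm _) _; apply: abs_ip_le (sq_ge0 _) _.
  by rewrite expr2 ler_wpM2r ?sq_ge0.
rewrite -/(sq (T v)); have := sq_ge0 (T v); rewrite le_eqVlt => /orP[/eqP<-|s0].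
  by move=> _; apply: pos.
move=> hh; rewrite -(ler_pM2r s0) -expr2; apply: le_trans hh _.
by rewrite ler_wpM2l// pos.
Qed.

(** By T^2 <= T the squared norms of the damped orbit decrease. By symmetry, inner
products of its even terms are such squared norms, so the even terms form a Cauchy
sequence; its limit is annihilated by [T], hence by [P], and lies in the range of
[P]. *)
Lemma decays_positive T P w :
  symmetric_op T -> (forall x, sq (T x) <= sq x) ->
  symmetric_op P -> (forall x, P (P x) = P x) ->
  (forall x, T (P x) = P (T x)) ->
  (forall u, P u = u -> 0 <= ip (T u) u) ->
  (forall x, T x = 0 -> P x = 0) ->
  P w = w -> decays T w.
Proof.
move=> sT cT sP PP TP pos kerT Pw.
pose u n := iter n (damp T) w; pose b n := sq (u n).
have Pu n : P (u n) = u n by rewrite /u -iter_damp_comm ?Pw.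
have bS n : b n.+1 + sq (T (u n)) <= b n.
  have := positive_contraction_sq_le sT cT TP pos (Pu n).
  rewrite /b /u iterS -/(u n) /damp sqB ipC; lra.
have b_le n m : (n <= m)%N -> b m <= b n.
  move=> /subnK<-; elim: (m - n)%N => // k; apply: le_trans.
  by rewrite addSn; have := bS (k + n)%N; have := sq_ge0 (T (u (k + n)%N)); lra.
have lB : has_inf (range b).
  by split; [exists (b 0%N), 0%N | exists 0 => _ [n _ <-]; exact: sq_ge0].
(* the squared norms [b] approach their infimum, so late values are close *)
have near (e : R) : 0 < e -> exists N, forall n m, (N <= n)%N -> (N <= m)%N ->
    b n < b m + e.
  move=> e0; have [_ [N _ <-] hN] := inf_adherent e0 lB.
  exists N => n m Nn _; apply: le_lt_trans (b_le _ _ Nn) _.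
  by apply: lt_le_trans hN _; rewrite lerD2r; apply: ge_inf; [case: lB|exists m].
have ipu n m : ip (u (n + n)%N) (u (m + m)%N) = b (n + m)%N.
  have ipa a c : ip (u a) (u c) = ip (u (c + a)%N) w.
    by rewrite /u iterD [RHS]iter_damp_sym.
  by rewrite /b /sq !ipa addnC addnACA.
have [z hz] : exists z, forall e : R, 0 < e -> exists N, forall n, (N <= n)%N ->
    sq (u (n + n)%N - z) < e.
  apply: sq_complete => e e0; have [N hN] := near (e / 2) ltac:(by rewrite divr_gt0).
  exists N => n m Nn Nm; rewrite sqB ipu -/(b _) -/(b _).
  have := hN (n + n)%N (n + m)%N
    (leq_trans Nn (leq_addr _ _)) (leq_trans Nn (leq_addr _ _)).
  have := hN (m + m)%N (n + m)%N
    (leq_trans Nm (leq_addr _ _)) (leq_trans Nn (leq_addr _ _)).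
  lra.
have Tz : T z = 0.
  apply: sq_arbitrarily_small => e e0.
  have e4 : 0 < e / 4 by rewrite divr_gt0.
  have [N hN] := near _ e4; have [N' hN'] := hz _ e4.
  set n := maxn N N'.
  have nN : (N <= n + n)%N by rewrite (leq_trans (leq_maxl N N')) ?leq_addr.
  have := hN' n (leq_maxr _ _).
  have := hN _ _ nN (leqW nN); have := bS (n + n)%N.
  have := cT (z - u (n + n)%N); rewrite linearB /= (sqBC z).
  have := sqD_le (T z - T (u (n + n)%N)) (T (u (n + n)%N)); rewrite subrK.
  lra.
have Pz := kerT _ Tz.
move=> e e0; have [N hN] := hz _ e0; exists (N + N)%N.
rewrite -/(u _) -Pu -[P _]subr0 -Pz -linearB /=.
exact: le_lt_trans (projection_sq_le _ sP PP) (hN N (leqnn N)).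
Qed.

(** Where [T] is nonpositive, damping is expansive, so no decay is possible. *)
Lemma decays_nonpositive T Q u :
  (forall x, T (Q x) = Q (T x)) -> (forall x, sq (Q x) <= sq x) ->
  (forall x, ip (T (Q x)) (Q x) <= 0) -> decays T u -> Q u = 0.
Proof.
move=> TQ cQ neg hu; apply: sq_arbitrarily_small => e /hu[n].
apply: le_lt_trans; apply: le_trans (cQ _).
rewrite -iter_damp_comm//; elim: n => //= n; move/le_trans; apply.
rewrite iter_damp_comm// /damp sqB ipC.
have := neg (iter n (damp T) u); have := sq_ge0 (T (Q (iter n (damp T) u))); lra.
Qed.

Lemma orthogonal_subspace L x y : orthogonal L x -> orthogonal L y ->
  orthogonal L (x - y).
Proof. by move=> hx hy z Lz; rewrite ipBl hx// hy// subrr. Qed.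

Lemma orthogonal_invariant (T : H -> H) L x :
  symmetric_op T -> (forall y, L y -> L (T y)) ->
  orthogonal L x -> orthogonal L (T x).
Proof. by move=> sT TL hx z Lz; rewrite sT hx//; apply: TL. Qed.

(** A reducing subspace splits the damped orbit orthogonally, and so splits decaying
vectors into decaying vectors. *)
Lemma decays_split T L l l' : symmetric_op T -> closed_subspace L ->
  (forall y, L y -> L (T y)) -> L l -> orthogonal L l' ->
  decays T (l + l') -> decays T l /\ decays T l'.
Proof.
move=> sT hL TL Ll Ll' hd.
have o n : ip (iter n (damp T) l) (iter n (damp T) l') = 0.
  rewrite ipC; have : orthogonal L (iter n (damp T) l').
    elim: n => //= n IH; apply: orthogonal_subspace => //.
    exact: orthogonal_invariant.
  by apply; apply: iter_damp_in.
split=> e /hd[n hn]; exists n; apply: le_lt_trans hn;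
  rewrite iter_dampD sqD o mulr0 addr0.
  by rewrite lerDl sq_ge0.
by rewrite lerDr sq_ge0.
Qed.

(** In j(u - Tu) = j(u) - 2 j(Tu, u) + j(Tu) both corrections are nonnegative on [L],
so [j] does not decrease along the damped orbit, where it is bounded by squared norms
that become arbitrarily small. *)
Lemma decays_form_eq0 T L (j : H -> H -> R) u : closed_subspace L ->
  (forall y, L y -> L (T y)) ->
  (forall x y, j (x - y) (x - y) = j x x - 2 * j y x + j y y) ->
  (forall x, j x x <= sq x) -> (forall x, L x -> 0 <= j x x) ->
  (forall x, L x -> j (T x) x <= 0) ->
  L u -> decays T u -> j u u = 0.
Proof.
move=> hL TL jB jle jge jT Lu hu; apply/eqP; rewrite eq_le jge// andbT.
apply/ler_addgt0Pl => e /hu[n hn]; rewrite addr0.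
apply: le_trans (ltW hn); apply: le_trans (jle _) => {hn}.
elim: n => //= n; move/le_trans; apply.
have Ln : L (iter n (damp T) u) by apply: iter_damp_in.
rewrite [X in _ <= j X X]/damp jB.
have := jT _ Ln; have := jge _ (TL _ Ln); lra.
Qed.

End damping.

(** * Commutation and sign properties of spectral measures *)

Section integral_sign.
Context (R : realType) (mu : {measure set (measurableTypeR R) -> \bar R}).
Context (D : set R) (f : R -> R).
Hypothesis mD : measurable (D : set (measurableTypeR R)).
Hypothesis muDC : mu (~` D) = 0%E.
Hypothesis fi : mu.-integrable setT (fun t => (f t)%:E).

Lemma Rintegral_carrier : \int[mu]_(t in setT) f t = \int[mu]_(t in D) f t.
Proof.
rewrite /Rintegral (negligible_integral (measurableC mD) measurableT fi muDC).
by rewrite setTD setCK.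
Qed.

Lemma Rintegral_carrier_ge0 : (forall t, D t -> 0 <= f t) ->
  0 <= \int[mu]_(t in setT) f t.
Proof. by move=> f0; rewrite Rintegral_carrier Rintegral_ge0. Qed.

Lemma Rintegral_carrier_eq0 : (forall t, D t -> 0 < f t) ->
  \int[mu]_(t in setT) f t = 0 -> mu setT = 0%E.
Proof.
move=> f0; rewrite Rintegral_carrier => If0.
have mDC := measurableC mD.
have fiD : mu.-integrable D (fun t => (f t)%:E) by apply: integrableS fi.
have I0 : (\int[mu]_(t in D) (f t)%:E = 0)%E.
  rewrite -[LHS]fineK; last exact: integrable_fin_num.
  by rewrite -[fine _]/(Rintegral _ _ _) If0.
have mfD := measurable_int mu fiD.
have : (\int[mu]_(t in D) `|(f t)%:E| = 0)%E.
  rewrite -I0; apply: eq_integral => t; rewrite inE => /f0 t0.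
  by rewrite gee0_abs// lee_fin ltW.
move=> /(ae_eq_integral_abs mu mD mfD) [N [mN muN sub]].
have muD : mu D = 0%E.
  apply: (subset_measure0 mD mN _ muN) => t Dt; apply: sub => /= /(_ Dt) [ft].
  by have := f0 _ Dt; rewrite ft ltxx.
have -> : [set: measurableTypeR R] = D `|` ~` D by rewrite setUv.
have muU : mu (D `|` ~` D) = (mu D + mu (~` D))%E.
  by apply: measureU => //; rewrite setICr.
by rewrite muU muD muDC adde0.
Qed.

End integral_sign.

Section spectral_parts.
Context (R : realType) (H : hilbertType R) (B : {linear H -> H}).
Context (E : set R -> {linear H -> H}) (lam : R).
Hypothesis hE : is_spectral_measure B E.
Implicit Types (D : set (measurableTypeR R)) (x u v : H).

Lemma spectral_sym D : measurable D -> symmetric_op (E D).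
Proof. by move=> mD x y; rewrite /ip (spectral_self_adjoint hE mD). Qed.

Lemma spectral_sq D x : measurable D -> ip (E D x) x = sq (E D x).
Proof. by move=> mD; rewrite /sq -spectral_sym// (spectral_idem hE). Qed.

Lemma spectral_sq_le D x : measurable D -> sq (E D x) <= sq x.
Proof.
move=> mD; apply: projection_sq_le; first exact: spectral_sym.
by move=> y; apply: (spectral_idem hE).
Qed.

(** Centering at [lam] turns the position of the support relative to [lam] into a sign
of the integrand. *)
Lemma spectral_scalar_measure x :
  exists mu : {measure set (measurableTypeR R) -> \bar R},
  [/\ forall D, measurable D -> mu D = (sq (E D x))%:E,
      mu.-integrable setT (fun t : R => (t - lam)%:E)
    & ip (B x - lam%:C *: x) x = \int[mu]_(t in setT) (t - lam)].
Proof.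
have [mu [muE mui Bx]] := spectral_integral hE x.
have muE' D : measurable D -> mu D = (sq (E D x))%:E.
  by move=> mD; rewrite muE// -spectral_sq.
have ci : mu.-integrable setT (fun _ : R => lam%:E).
  apply/integrableP; split; first exact: measurable_cst.
  have -> : (\int[mu]_x `|lam%:E| = `|lam|%:E * mu setT)%E by exact: integral_cst.
  by rewrite muE'// -EFinM ltry.
exists mu; split => //.
  by have := integrableB measurableT mui ci; apply: eq_integrable.
rewrite RintegralB// Rintegral_cst// muE'//= (spectral_setT hE) ipBl ipZl.
by rewrite {1}/ip Bx.
Qed.

Lemma spectral_set0 x : E set0 x = 0.
Proof.
have [mu [muE _ _]] := spectral_integral hE x.
have := muE _ measurable0; rewrite measure0 => -[/esym Ex].
by apply: sq_eq0; rewrite -spectral_sq.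
Qed.

Lemma spectral_disjoint D1 D2 x : measurable D1 -> measurable D2 ->
  D1 `&` D2 = set0 -> E D1 (E D2 x) = 0.
Proof. by move=> m1 m2 D12; rewrite -(spectral_setI hE)// D12 spectral_set0. Qed.

Lemma spectral_form_ge0 D (s : R) u : measurable D ->
  (forall t, D t -> 0 <= s * (t - lam)) -> E D u = u ->
  0 <= s * ip (B u - lam%:C *: u) u.
Proof.
move=> mD sD Du; have [mu [muE mui ->]] := spectral_scalar_measure u.
have muC : mu (~` D) = 0%E.
  rewrite muE; last exact: (measurableC mD).
  by rewrite -Du spectral_disjoint ?sq0 ?setICl//; exact: (measurableC mD).
rewrite -RintegralZl//; apply: (Rintegral_carrier_ge0 mD muC) sD.
by have := integrableZl measurableT s mui; apply: eq_integrable.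
Qed.

(** The integral of a strictly signed function vanishes only for the zero measure, and
the total mass of the scalar spectral measure is the squared norm. *)
Lemma spectral_form_eq0 D (s : R) u : measurable D ->
  (forall t, D t -> 0 < s * (t - lam)) -> E D u = u ->
  ip (B u - lam%:C *: u) u = 0 -> u = 0.
Proof.
move=> mD sD Du; have [mu [muE mui ->]] := spectral_scalar_measure u.
have muC : mu (~` D) = 0%E.
  rewrite muE; last exact: (measurableC mD).
  by rewrite -Du spectral_disjoint ?sq0 ?setICl//; exact: (measurableC mD).
move=> I0; have si : mu.-integrable setT (fun t : R => (s * (t - lam))%:E).
  by have := integrableZl measurableT s mui; apply: eq_integrable.
have : \int[mu]_(t in setT) (s * (t - lam)) = 0 by rewrite RintegralZl// I0 mulr0.
move=> /(Rintegral_carrier_eq0 mD muC si sD); rewrite muE// (spectral_setT hE).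
by move=> -[/sq_eq0].
Qed.

(** For u in the range of [E D] and v in its kernel, the scalar spectral measure of
u + v is the sum of those of u and v. So the form of [B] has no cross term between u
and v, which says that both subspaces are invariant under [B]. *)
Lemma spectral_comm D x : symmetric_op B -> measurable D ->
  B (E D x) = E D (B x).
Proof.
move=> sB mD.
have cross u v : E D u = u -> E D v = 0 -> ip (B u) v = 0.
  move=> Du Dv.
  have [m1 [m1E m1i I1]] := spectral_integral hE u.
  have [m2 [m2E m2i I2]] := spectral_integral hE v.
  have [m [mE mi I]] := spectral_integral hE (u + v).
  have madd A : measurable A -> A `<=` setT -> m A = measure_add m1 m2 A.
    move=> mA _; rewrite measure_addE mE// m1E// m2E// -EFinD; congr _%:E.
    rewrite -/(ip _ _) -/(ip (E A u) u) -/(ip (E A v) v) linearD !ipE.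
    have -> : ip (E A v) u = ip (E A u) v by rewrite spectral_sym// ipC.
    suff -> : ip (E A u) v = 0 by ring.
    rewrite -Du -(spectral_setI hE)// setIC (spectral_setI hE)//.
    by rewrite spectral_sym// Dv ip0r.
  have : ip (B (u + v)) (u + v) = ip (B u) u + ip (B v) v.
    rewrite {1}/ip I {1}/ip I1 {1}/ip I2 /= /Rintegral.
    rewrite (eq_measure_integral _ madd) integral_measure_add// fineD//;
      exact: integrable_fin_num.
  rewrite linearD !ipE (sB v u) (ipC v); lra.
have BE y : E D (B (E D y)) = B (E D y).
  apply: ip_ext => z; rewrite -[z](subrK (E D z)) !(ipDr _ (E D z)).
  have Dz : E D (z - E D z) = 0 by rewrite linearB /= (spectral_idem hE)// subrr.
  rewrite cross ?(spectral_idem hE)// spectral_sym// Dz ip0r.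
  by rewrite spectral_sym// (spectral_idem hE).
apply: ip_ext => z.
by rewrite [RHS]spectral_sym// [RHS]sB -[in RHS]BE -[RHS]spectral_sym//
  -[RHS]sB -[RHS]spectral_sym// BE.
Qed.

End spectral_parts.

(** * Spectral subspaces described by decay *)

(** A small factor [e] makes B - lam a contraction, as the damped iterations need; it
changes neither kernels nor signs. *)
Definition scaled_shift (R : realType) (H : hilbertType R) (B : H -> H)
  (lam e : R) (x : H) : H := e%:C *: shift_op B lam%:C x.

Section scaled_shift_linear.
Context (R : realType) (H : hilbertType R) (B : {linear H -> H}) (lam e : R).

Lemma scaled_shift_linear : linear (scaled_shift B lam e).
Proof.
move=> c x y; rewrite /scaled_shift /shift_op linearP /=.
have -> : c *: B x + B y - lam%:C *: (c *: x + y) =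
    c *: (B x - lam%:C *: x) + (B y - lam%:C *: y).
  by rewrite scalerBr scalerDr opprD addrACA !scalerA (mulrC c).
by rewrite scalerDr !scalerA (mulrC c).
Qed.

HB.instance Definition _ := GRing.isLinear.Build R[i] H H *:%R
  (scaled_shift B lam e) scaled_shift_linear.

End scaled_shift_linear.

(** What the later arguments retain of the spectral measure: the three spectral
subspaces, given by decay and by the kernel, are mutually orthogonal and span. *)
Record sign_splitting (R : realType) (H : hilbertType R) (T : H -> H) : Prop := {
  sign_sum : forall h, exists a b c,
    [/\ decays (\- T) a, T b = 0, decays T c & h = a + b + c] ;
  sign_orth : forall a c, decays (\- T) a -> decays T c -> ip a c = 0 ;
  sign_orth_neg : forall a b, decays (\- T) a -> T b = 0 -> ip a b = 0 ;
  sign_orth_pos : forall b c, T b = 0 -> decays T c -> ip b c = 0 }.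

Section spectral_splitting.
Context (R : realType) (H : hilbertType R) (B : {linear H -> H}).
Context (E : set R -> {linear H -> H}) (lam e : R).
Hypothesis hE : is_spectral_measure B E.
Hypothesis sB : symmetric_op B.
Hypothesis e0 : 0 < e.
Notation T := (scaled_shift B lam e).
Hypothesis cT : forall x, sq (T x) <= sq x.
Notation Dm := (`]-oo, lam[%classic : set R).
Notation Dz := ([set lam] : set R).
Notation Dp := (`]lam, +oo[%classic : set R).

Lemma scaled_shift_sym : symmetric_op T.
Proof. by move=> x y; rewrite /scaled_shift !ipZl !ipZr /shift_op !ipE sB. Qed.

Lemma measurable_below : measurable (Dm : set (measurableTypeR R)).
Proof. exact: measurable_itv. Qed.

Lemma measurable_at : measurable (Dz : set (measurableTypeR R)).
Proof. exact: measurable_set1. Qed.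

Lemma measurable_above : measurable (Dp : set (measurableTypeR R)).
Proof. exact: measurable_itv. Qed.

Let mm := measurable_below. Let mz := measurable_at. Let mp := measurable_above.

Lemma below_at_disjoint : Dm `&` Dz = set0.
Proof.
by rewrite -subset0 => t [/= + tl]; rewrite tl in_itv /= ltxx.
Qed.

Lemma below_above_disjoint : Dm `&` Dp = set0.
Proof.
by rewrite -subset0 => t [/=]; rewrite !in_itv /= andbT => /lt_trans h /h; rewrite ltxx.
Qed.

Lemma at_above_disjoint : Dz `&` Dp = set0.
Proof.
by rewrite -subset0 => t [/= ->]; rewrite in_itv /= ltxx.
Qed.

Lemma scaled_shift_comm D x : measurable (D : set (measurableTypeR R)) ->
  T (E D x) = E D (T x).
Proof.
move=> mD; rewrite /scaled_shift /shift_op (spectral_comm hE x sB mD).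
by rewrite [RHS]linearZ /= [in RHS]linearB /= [in RHS]linearZ.
Qed.

Lemma scaled_shift_form x : ip (T x) x = e * ip (B x - lam%:C *: x) x.
Proof. exact: ipZl. Qed.

Lemma spectral_sum x : x = E Dm x + E Dz x + E Dp x.
Proof.
apply/eqP; rewrite -subr_eq0; apply/eqP; set y := _ - _.
have Ey D : E D y = E D x - (E D (E Dm x) + E D (E Dz x) + E D (E Dp x)).
  by rewrite /y (linearB (E D)) !(linearD (E D)).
have ym : E Dm y = 0.
  rewrite Ey (spectral_idem hE)//.
  rewrite !(spectral_disjoint hE) ?below_at_disjoint ?below_above_disjoint//.
  by rewrite !addr0 subrr.
have yz : E Dz y = 0.
  rewrite Ey (spectral_idem hE)//.
  rewrite !(spectral_disjoint hE) ?at_above_disjoint ?(setIC Dz) ?below_at_disjoint//.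
  by rewrite add0r addr0 subrr.
have yp : E Dp y = 0.
  rewrite Ey (spectral_idem hE)//.
  rewrite !(spectral_disjoint hE) ?(setIC Dp) ?below_above_disjoint ?at_above_disjoint//.
  by rewrite !add0r subrr.
(* the scalar measure of [y] vanishes on the three pieces, and its mass is |y|^2 *)
have [mu [muE _ _]] := spectral_scalar_measure lam hE y.
have := muE setT measurableT; rewrite (spectral_setT hE).
have -> : [set: measurableTypeR R] = Dm `|` (Dz `|` Dp).
  apply/seteqP; split=> // t _; have [tl|tl|->] := ltgtP t lam.
  - by left; rewrite /= in_itv.
  - by right; right; rewrite /= in_itv /= tl.
  - by right; left.
have muU : mu (Dm `|` (Dz `|` Dp)) = (mu Dm + (mu Dz + mu Dp))%E.
  have <- : mu (Dz `|` Dp) = (mu Dz + mu Dp)%E.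
    by apply: measureU => //; exact: at_above_disjoint.
  apply: measureU => //; first exact: measurableU.
  by rewrite setIUr below_at_disjoint below_above_disjoint setU0.
by rewrite muU !muE// ym yz yp sq0 !adde0 => -[/esym/sq_eq0].
Qed.

Lemma form_below_le0 u : E Dm u = u -> ip (T u) u <= 0.
Proof.
move=> Du; rewrite scaled_shift_form pmulr_rle0//.
have := spectral_form_ge0 (lam := lam) (s := -1) hE mm _ Du.
rewrite mulN1r oppr_ge0; apply => t /=.
by rewrite in_itv /= mulN1r oppr_ge0 subr_le0 => /ltW.
Qed.

Lemma form_above_ge0 u : E Dp u = u -> 0 <= ip (T u) u.
Proof.
move=> Du; rewrite scaled_shift_form pmulr_rge0//.
have := spectral_form_ge0 (lam := lam) (s := 1) hE mp _ Du.
rewrite mul1r; apply => t /=.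
by rewrite in_itv /= andbT mul1r subr_ge0 => /ltW.
Qed.

(** On the range of [E [set lam]] the form of [T] vanishes; as [T] preserves this range,
polarization at u and Tu gives |Tu|^2 = 0. *)
Lemma scaled_shift_zero u : E Dz u = u -> T u = 0.
Proof.
have form0 v : E Dz v = v -> ip (T v) v = 0.
  move=> Dv; rewrite scaled_shift_form.
  have h s : 0 <= s * ip (B v - lam%:C *: v) v.
    by apply: (spectral_form_ge0 hE mz _ Dv) => t /= ->; rewrite subrr mulr0.
  have := h 1; have := h (-1); rewrite mulN1r mul1r oppr_ge0 => h1 h2.
  suff -> : ip (B v - lam%:C *: v) v = 0 by rewrite mulr0.
  by apply/eqP; rewrite eq_le h1 h2.
move=> Du; have DTu : E Dz (T u) = T u by rewrite -scaled_shift_comm// Du.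
have : ip (T (u + T u)) (u + T u) = 0.
  by apply: form0; rewrite linearD /= Du DTu.
rewrite (linearD T) !(ipDl, ipDr) (form0 u)// (form0 (T u))//
  [ip (T (T u)) u]scaled_shift_sym.
by move=> h; apply: sq_eq0; rewrite /sq; move: h; lra.
Qed.

Lemma kernel_below_eq0 u : T u = 0 -> E Dm u = 0.
Proof.
move=> Tu; apply: (spectral_form_eq0 (lam := lam) (s := -1) hE mm).
- by move=> t /=; rewrite in_itv /= mulN1r oppr_gt0 subr_lt0.
- exact: (spectral_idem hE).
apply: (mulfI (lt0r_neq0 e0)); rewrite mulr0 -scaled_shift_form.
by rewrite scaled_shift_comm// Tu linear0 ip0l.
Qed.

Lemma kernel_above_eq0 u : T u = 0 -> E Dp u = 0.
Proof.
move=> Tu; apply: (spectral_form_eq0 (lam := lam) (s := 1) hE mp).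
- by move=> t /=; rewrite in_itv /= andbT mul1r subr_gt0.
- exact: (spectral_idem hE).
apply: (mulfI (lt0r_neq0 e0)); rewrite mulr0 -scaled_shift_form.
by rewrite scaled_shift_comm// Tu linear0 ip0l.
Qed.

Lemma spectral_kernelP u : T u = 0 <-> E Dz u = u.
Proof.
split=> [Tu|]; last exact: scaled_shift_zero.
by rewrite [RHS]spectral_sum kernel_below_eq0// kernel_above_eq0// add0r addr0.
Qed.

(** [T] is strictly positive above [lam], so vectors there decay; below and at [lam] it
is nonpositive, which excludes components there. *)
Lemma spectral_posP u : decays T u <-> E Dp u = u.
Proof.
split=> [hu|]; last first.
  apply: (decays_positive (P := E Dp)) => //.
  - exact: scaled_shift_sym.
  - exact: (spectral_sym hE mp).
  - by move=> x; apply: (spectral_idem hE).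
  - by move=> x; apply: scaled_shift_comm.
  - exact: form_above_ge0.
  - exact: kernel_above_eq0.
rewrite [RHS]spectral_sum.
have -> : E Dm u = 0.
  apply: decays_nonpositive hu => x; first exact: scaled_shift_comm.
    exact: (spectral_sq_le hE).
  by apply: form_below_le0; apply: (spectral_idem hE).
have -> : E Dz u = 0.
  apply: decays_nonpositive hu => x; first exact: scaled_shift_comm.
    exact: (spectral_sq_le hE).
  by rewrite /= scaled_shift_zero ?ip0l//; apply: (spectral_idem hE).
by rewrite !add0r.
Qed.

Lemma spectral_negP u : decays (\- T) u <-> E Dm u = u.
Proof.
split=> [hu|]; last first.
  apply: (decays_positive (P := E Dm)) => //.
  - by move=> x y /=; rewrite ipNl ipNr scaled_shift_sym.
  - by move=> x /=; rewrite sqN.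
  - exact: (spectral_sym hE mm).
  - by move=> x; apply: (spectral_idem hE).
  - by move=> x /=; rewrite scaled_shift_comm// linearN.
  - by move=> x Dx /=; rewrite ipNl oppr_ge0 form_below_le0.
  - by move=> x /= /eqP; rewrite oppr_eq0 => /eqP; apply: kernel_below_eq0.
rewrite [RHS]spectral_sum.
have -> : E Dp u = 0.
  apply: decays_nonpositive hu => x /=.
  - by rewrite scaled_shift_comm// linearN.
  - exact: (spectral_sq_le hE).
  - by rewrite ipNl oppr_le0 form_above_ge0//; apply: (spectral_idem hE).
have -> : E Dz u = 0.
  apply: decays_nonpositive hu => x /=.
  - by rewrite scaled_shift_comm// linearN.
  - exact: (spectral_sq_le hE).
  - by rewrite scaled_shift_zero ?oppr0 ?ip0l//; apply: (spectral_idem hE).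
by rewrite !addr0.
Qed.

Lemma spectral_sign_splitting : sign_splitting T.
Proof.
have orth D D' x y : measurable (D : set (measurableTypeR R)) ->
    measurable (D' : set (measurableTypeR R)) -> D `&` D' = set0 ->
    E D x = x -> E D' y = y -> ip x y = 0.
  move=> mD mD' DD' <- <-.
  by rewrite (spectral_sym hE)// (spectral_disjoint hE)// ip0r.
split.
- move=> h; exists (E Dm h), (E Dz h), (E Dp h); split.
  + by apply/spectral_negP; apply: (spectral_idem hE).
  + by apply/spectral_kernelP; apply: (spectral_idem hE).
  + by apply/spectral_posP; apply: (spectral_idem hE).
  + exact: spectral_sum.
- by move=> a c /spectral_negP Ha /spectral_posP Hc;
  apply: orth Ha Hc => //; exact: below_above_disjoint.
- by move=> a b /spectral_negP Ha /spectral_kernelP Hb;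
  apply: orth Ha Hb => //; exact: below_at_disjoint.
- by move=> b c /spectral_kernelP Hb /spectral_posP Hc;
  apply: orth Hb Hc => //; exact: at_above_disjoint.
Qed.

End spectral_splitting.

(** * The spectrum and the numerical range *)

Section numerical_range.
Context (R : realType).

Definition sq_bounded (H K : hilbertType R) (T : H -> K) : Prop :=
  exists2 M : R, 0 < M & forall x, sq (T x) <= M ^+ 2 * sq x.

Lemma bounded_sq (H K : hilbertType R) (T : H -> K) :
  bounded_operator T -> sq_bounded T.
Proof.
move=> [M hM]; exists (`|M| + 1) => [|x]; first by rewrite ltr_wpDl.
have := hM x; rewrite (normE (T x)) (normE x) lecE /= => /andP[_].
rewrite mul0r subr0 !sqE => h.
have := normr_ge0 (T x); rewrite (normE (T x)) lecE /= => /andP[_ a0].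
have := normr_ge0 x; rewrite (normE x) lecE /= => /andP[_ b0].
rewrite -exprMn ler_sqr ?nnegrE// ?mulr_ge0 ?addr_ge0//.
by apply: le_trans h _; rewrite ler_wpM2r// (le_trans (ler_norm _))// lerDl.
Qed.

(** |Sy|^2 = <TSy, y>, then Cauchy--Schwarz and division by |Sy|^2. *)
Lemma adjoint_bounded_sq (H K : hilbertType R) (T : H -> K) (S : K -> H) :
  (forall x y, ip (T x) y = ip x (S y)) -> sq_bounded T -> sq_bounded S.
Proof.
move=> TS [M M0 hT]; exists M => // y; have [->|/eqP s0] := eqVneq (sq (S y)) 0.
  by rewrite mulr_ge0 ?sq_ge0// sqr_ge0.
have {s0} s0 : 0 < sq (S y) by rewrite lt_neqAle sq_ge0 andbT eq_sym; apply/eqP.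
have := ip_sqr_le (T (S y)) y; rewrite TS -/(sq (S y)) => h.
rewrite -(ler_pM2l s0) -expr2; apply: le_trans h _.
rewrite mulrA (mulrC (sq _) (M ^+ 2)).
by rewrite ler_wpM2r ?sq_ge0.
Qed.

Variable H : hilbertType R.
Implicit Types A : {linear H -> H}.

Lemma normalize (x : H) : x != 0 -> exists2 a : R, 0 < a & sq (a%:C *: x) = 1.
Proof.
move=> x0; have s0 : 0 < sq x.
  by rewrite lt_neqAle sq_ge0 andbT eq_sym; apply: contra x0 => /eqP/sq_eq0->.
exists (Num.sqrt (sq x))^-1; first by rewrite invr_gt0 sqrtr_gt0.
by rewrite sqZ exprVn sqr_sqrtr ?sq_ge0// mulVf// gt_eqF.
Qed.

(** The supremum [m] of the numerical range is an approximate eigenvalue: where the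
positive form of m - A is small, Cauchy--Schwarz makes the vector (m - A)x small, which
a bounded inverse would forbid. *)
Lemma numerical_sup_in_spectrum A (x0 : H) :
  bounded_operator A -> symmetric_op A -> x0 != 0 ->
  exists2 m : R, real_spectrum A m & forall x, ip (A x) x <= m * sq x.
Proof.
move=> /bounded_sq[M M0 hM] sA x0n.
pose N := [set ip (A x) x | x in [set x : H | sq x = 1]].
have supN : has_sup N.
  split.
    by have [a _ a1] := normalize x0n;
      exists (ip (A (a%:C *: x0)) (a%:C *: x0)), (a%:C *: x0).
  exists M => _ [x /= x1 <-]; apply: le_trans (ler_norm _) _.
  by apply: abs_ip_le; [exact: ltW|have := hM x; rewrite x1 !mulr1].
pose m := sup N.
have mle x : ip (A x) x <= m * sq x.
  have [->|xn] := eqVneq x 0; first by rewrite linear0 ip0l sq0 mulr0.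
  have [a a0 a1] := normalize xn.
  have : ip (A (a%:C *: x)) (a%:C *: x) <= m.
    by apply: ub_le_sup; [case: supN|exists (a%:C *: x)].
  rewrite linearZ /= ipZl ipZr => h.
  have : a ^+ 2 * ip (A x) x <= a ^+ 2 * (m * sq x).
    rewrite mulrCA -sqZ a1 mulr1; apply: le_trans h; by rewrite expr2 mulrA.
  by rewrite ler_pM2l// exprn_gt0.
exists m => // -[S [Sb SK _]].
have [L L0 hL] := bounded_sq Sb.
(* C is m - A, in the shape of an existing linear map *)
pose C : {linear H -> H} := scaled_shift A m (-1).
have CE x : C x = - shift_op A m%:C x.
  by rewrite /C /= /scaled_shift rmorphN1 scaleN1r.
have sC : symmetric_op C by exact: scaled_shift_sym.
have Cform x : ip (C x) x = m * sq x - ip (A x) x.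
  by rewrite CE ipNl /shift_op ipBl ipZl opprB.
have posC x : 0 <= ip (C x) x by rewrite Cform subr_ge0.
pose K := 2 * M ^+ 2 + 2 * m ^+ 2 + 1.
have K1 : 1 <= K by rewrite lerDr addr_ge0// mulr_ge0// sqr_ge0.
have hC x : sq (C x) <= K * sq x.
  rewrite CE sqN /shift_op.
  have := sqD_le (A x) (- (m%:C *: x)); rewrite sqN sqZ.
  have := hM x; have := sq_ge0 x; rewrite /K; lra.
have sqC x : sq (C x) <= K * ip (C x) x.
  have := symmetric_form_sqr_le sC (fun s => posC (x + s%:C *: C x)) (posC (C x)).
  rewrite -/(sq (C x)) => h.
  have h2 : ip (C (C x)) (C x) <= K * sq (C x).
    apply: le_trans (ler_norm _) _; apply: abs_ip_le.
      by rewrite mulr_ge0 ?sq_ge0// (le_trans _ K1).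
    have := hC (C x); have := sq_ge0 (C x); set a := sq (C x); set b := sq _ => a0 ab.
    have : b * a <= K * a * a by rewrite ler_wpM2r.
    move/le_trans; apply; rewrite exprMn expr2 -mulrA -expr2.
    by rewrite ler_wpM2r ?sqr_ge0// ler_peMl// (le_trans _ K1).
  have [->|/eqP s0] := eqVneq (sq (C x)) 0.
    by rewrite mulr_ge0// (le_trans _ K1).
  have {s0} s0 : 0 < sq (C x) by rewrite lt_neqAle sq_ge0 andbT eq_sym; apply/eqP.
  rewrite -(ler_pM2r s0) -expr2; apply: le_trans h _.
  by rewrite mulrAC mulrC ler_wpM2r.
have LK : 0 < L ^+ 2 * K by rewrite mulr_gt0 ?exprn_gt0// (lt_le_trans _ K1).
have d0 : 0 < (2 * (L ^+ 2 * K))^-1 by rewrite invr_gt0 mulr_gt0.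
have [_ [x /= x1 <-] xm] := sup_adherent d0 supN.
have : sq x <= L ^+ 2 * sq (C x) by rewrite CE sqN -{1}(SK x) hL.
rewrite x1 => h1.
have h2 : L ^+ 2 * sq (C x) <= L ^+ 2 * K * ip (C x) x.
  by rewrite -mulrA ler_pM2l ?exprn_gt0.
have h3 : L ^+ 2 * K * ip (C x) x < L ^+ 2 * K * (2 * (L ^+ 2 * K))^-1.
  by rewrite ltr_pM2l// Cform x1 mulr1 ltrBlDl -ltrBlDr.
have := le_lt_trans (le_trans h1 h2) h3.
rewrite invfM mulrCA divff ?gt_eqF// mulr1.
by rewrite invf_gt1// ltrn1.
Qed.

Lemma form_le_of_spectrum A (lam : R) x :
  bounded_operator A -> symmetric_op A ->
  (ereal_sup (EFin @` real_spectrum A) <= lam%:E)%E -> ip (A x) x <= lam * sq x.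
Proof.
move=> bA sA sup; have [->|x0] := eqVneq x 0; first by rewrite linear0 ip0l sq0 mulr0.
have [m sm hm] := numerical_sup_in_spectrum bA sA x0.
apply: le_trans (hm x) _; rewrite ler_wpM2r ?sq_ge0// -lee_fin.
by apply: le_trans sup; apply: ereal_sup_ubound; exists m.
Qed.

Lemma form_ge_of_spectrum A (lam : R) x :
  bounded_operator A -> symmetric_op A ->
  (lam%:E <= ereal_inf (EFin @` real_spectrum A))%E -> lam * sq x <= ip (A x) x.
Proof.
move=> bA sA inf; have [->|x0] := eqVneq x 0; first by rewrite linear0 ip0l sq0 mulr0.
have bA' : bounded_operator (\- A).
  by case: bA => M hM; exists M => y /=; rewrite normrN.
have sA' : symmetric_op (\- A) by move=> y z /=; rewrite ipNl ipNr sA.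
have [m sm hm] := numerical_sup_in_spectrum bA' sA' x0.
have := hm x; rewrite /= ipNl lerNl -mulNr; apply: le_trans.
rewrite ler_wpM2r ?sq_ge0// -lee_fin.
apply: le_trans inf _; apply: ereal_inf_lbound; exists (- m) => //.
move=> [S [Sb SK KS]]; apply: sm; exists (\- S); split.
- by case: Sb => L hL; exists L => y /=; rewrite normrN.
- move=> y /=; rewrite -{2}(SK y) -linearN; congr (S _).
  by rewrite /shift_op /= rmorphN scaleNr !opprD !opprK.
- move=> y /=; rewrite -{2}(KS y) /shift_op /= linearN opprK.
  by rewrite rmorphN scaleNr scalerN.
Qed.

End numerical_range.

(** * Kernels of the shifted blocks and the spaces K_0 and K_1 *)

Section form_kernel.
Context (R : realType) (H : hilbertType R).

Lemma adjoint_ip (K : hilbertType R) (T : H -> K) (S : K -> H) :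
  is_adjoint T S -> forall x y, ip (T x) y = ip x (S y).
Proof. by move=> h x y; rewrite /ip h. Qed.

(** Cauchy--Schwarz for the form of [T] at x and Tx. *)
Lemma nonneg_form_kernel (T : {linear H -> H}) x : symmetric_op T ->
  (forall y, 0 <= ip (T y) y) -> ip (T x) x = 0 -> T x = 0.
Proof.
move=> sT pos Tx.
have := symmetric_form_sqr_le sT (fun s => pos (x + s%:C *: T x)) (pos (T x)).
rewrite Tx mul0r -/(sq (T x)) => h; apply: sq_eq0; apply/eqP.
by rewrite -sqrf_eq0 eq_le h sqr_ge0.
Qed.

Lemma shift_op_sym (A : {linear H -> H}) (lam : R) :
  symmetric_op A -> symmetric_op (shift_op A lam%:C).
Proof. by move=> sA x y; rewrite /shift_op !ipE sA. Qed.

Lemma shift_form_max (A : {linear H -> H}) (lam : R) x : symmetric_op A ->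
  (forall y, ip (A y) y <= lam * sq y) ->
  ip (shift_op A lam%:C x) x = 0 -> shift_op A lam%:C x = 0.
Proof.
move=> sA le Ax.
have neg y : ip (scaled_shift A lam (-1) y) y = lam * sq y - ip (A y) y.
  by rewrite ipZl mulN1r /shift_op ipBl ipZl opprB.
have : scaled_shift A lam (-1) x = 0.
  apply: nonneg_form_kernel; first exact: scaled_shift_sym.
    by move=> y; rewrite /= neg subr_ge0.
  by rewrite /= ipZl Ax mulr0.
rewrite /scaled_shift rmorphN1 scaleN1r => /eqP.
by rewrite oppr_eq0 => /eqP.
Qed.

Lemma shift_form_min (A : {linear H -> H}) (lam : R) x : symmetric_op A ->
  (forall y, lam * sq y <= ip (A y) y) ->
  ip (shift_op A lam%:C x) x = 0 -> shift_op A lam%:C x = 0.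
Proof.
move=> sA le Ax.
have TE y : scaled_shift A lam 1 y = shift_op A lam%:C y.
  by rewrite /scaled_shift rmorph1 scale1r.
rewrite -TE; apply: nonneg_form_kernel; first exact: scaled_shift_sym.
  by move=> y; rewrite /= TE /shift_op ipBl ipZl subr_ge0; exact: le.
by rewrite /= TE.
Qed.

End form_kernel.

Section kernel_core.
Context (R : realType) (H0 H1 : hilbertType R).
Context (A0 : {linear H0 -> H0}) (A1 : {linear H1 -> H1}).
Context (V : {linear H1 -> H0}) (Vs : {linear H0 -> H1}) (lam : R).

(** The set whose closure is K_0, and K_1 after exchanging the two spaces. *)
Definition kernel_core : set H0 := [set x |
  [/\ ker (shift_op A0 lam%:C) x, range V x
    & forall n, ker (shift_op A1 lam%:C) (Vs (iter n (V \o Vs) x)) /\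
                ker (shift_op A0 lam%:C) (iter n (V \o Vs) x)]].

Lemma shift_op0 (K : hilbertType R) (A : {linear K -> K}) (c : R[i]) :
  shift_op A c 0 = 0.
Proof. by rewrite /shift_op linear0 scaler0 subrr. Qed.

Lemma shift_opD (K : hilbertType R) (A : {linear K -> K}) (c : R[i]) x y :
  shift_op A c (x + y) = shift_op A c x + shift_op A c y.
Proof. by rewrite /shift_op linearD scalerDr opprD addrACA. Qed.

Lemma shift_opZ (K : hilbertType R) (A : {linear K -> K}) (c d : R[i]) x :
  shift_op A c (d *: x) = d *: shift_op A c x.
Proof. by rewrite /shift_op linearZ scalerBr !scalerA mulrC. Qed.

Lemma iter_comp0 n : iter n (V \o Vs) 0 = 0.
Proof. by elim: n => //= n ->; rewrite !linear0. Qed.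

Lemma iter_compD n x y :
  iter n (V \o Vs) (x + y) = iter n (V \o Vs) x + iter n (V \o Vs) y.
Proof. by elim: n => //= n ->; rewrite !linearD. Qed.

Lemma iter_compZ n c x : iter n (V \o Vs) (c *: x) = c *: iter n (V \o Vs) x.
Proof. by elim: n => //= n ->; rewrite !linearZ. Qed.

Lemma kernel_core0 : kernel_core 0.
Proof.
split; [exact: shift_op0|by exists 0; rewrite ?linear0|move=> n].
by rewrite iter_comp0 linear0; split; exact: shift_op0.
Qed.

Lemma kernel_coreD x y : kernel_core x -> kernel_core y -> kernel_core (x + y).
Proof.
move=> [kx [z _ zx] hx] [ky [w _ wy] hy]; split.
- by rewrite /ker /= shift_opD kx ky addr0.
- by exists (z + w); rewrite ?linearD ?zx ?wy.
move=> n; rewrite iter_compD linearD /ker /= !shift_opD.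
by have [-> ->] := hx n; have [-> ->] := hy n; rewrite !addr0.
Qed.

Lemma kernel_coreZ c x : kernel_core x -> kernel_core (c *: x).
Proof.
move=> [kx [z _ zx] hx]; split.
- by rewrite /ker /= shift_opZ kx scaler0.
- by exists (c *: z); rewrite ?linearZ ?zx.
move=> n; rewrite iter_compZ linearZ /ker /= !shift_opZ.
by have [-> ->] := hx n; rewrite !scaler0.
Qed.

Lemma kernel_core_closure :
  closed_subspace (invariant_kernel A0 A1 V Vs lam).
Proof.
exact: (closure_subspace kernel_core0 kernel_coreD kernel_coreZ).
Qed.

Lemma invariant_kernel_trivial :
  invariant_kernel A0 A1 V Vs lam = [set 0] <-> forall x, kernel_core x -> x = 0.
Proof.
split=> [K0 x cx|h].
  have : invariant_kernel A0 A1 V Vs lam x by apply: subset_closure.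
  by rewrite K0.
apply/seteqP; split=> [x /closure_sq hx|_ ->]; last first.
  exact: (subset_closure kernel_core0).
by apply: sq_arbitrarily_small => e /hx[y /h->]; rewrite subr0.
Qed.

End kernel_core.

Section kernel_core_swap.
Context (R : realType) (H0 H1 : hilbertType R).
Context (A0 : {linear H0 -> H0}) (A1 : {linear H1 -> H1}).
Context (V : {linear H1 -> H0}) (Vs : {linear H0 -> H1}) (lam : R).
Hypothesis VVs : forall x y, ip (V x) y = ip x (Vs y).

Lemma iter_comp_swap n x : Vs (iter n (V \o Vs) x) = iter n (Vs \o V) (Vs x).
Proof. by elim: n x => //= n IH x; rewrite IH. Qed.

(** Applying V^* shifts the alternating words in V and V^* by one letter. *)
Lemma kernel_core_adjoint x :
  kernel_core A0 A1 V Vs lam x -> kernel_core A1 A0 Vs V lam (Vs x).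
Proof.
move=> [kx _ hx]; split; [by have [] := hx 0%N|by exists x|move=> n].
rewrite -iter_comp_swap; split; first by have [_] := hx n.+1.
by have [] := hx n.
Qed.

(** [x] lies in the range of V, which is orthogonal to the kernel of V^*. *)
Lemma kernel_core_adjoint_inj x :
  kernel_core A0 A1 V Vs lam x -> Vs x = 0 -> x = 0.
Proof.
move=> [_ [z _ <-] _] Vx; apply: sq_eq0.
by rewrite /sq VVs Vx ip0r.
Qed.

Lemma kernel_core_trivial_swap :
  (forall x, kernel_core A1 A0 Vs V lam x -> x = 0) ->
  forall x, kernel_core A0 A1 V Vs lam x -> x = 0.
Proof.
by move=> h x cx; apply: kernel_core_adjoint_inj => //; apply/h/kernel_core_adjoint.
Qed.

Lemma core_closure_map x : sq_bounded Vs ->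
  invariant_kernel A0 A1 V Vs lam x -> invariant_kernel A1 A0 Vs V lam (Vs x).
Proof.
move=> [M M0 hV] /closure_sq hx; apply/closure_sq => e e0.
have [y cy xy] := hx _ (divr_gt0 e0 (exprn_gt0 2 M0)).
exists (Vs y); first exact: kernel_core_adjoint.
rewrite -linearB; apply: le_lt_trans (hV _) _.
by move: xy; rewrite ltr_pdivlMr ?exprn_gt0// mulrC.
Qed.

Lemma core_closure_shift x : sq_bounded A0 ->
  invariant_kernel A0 A1 V Vs lam x -> shift_op A0 lam%:C x = 0.
Proof.
move=> [M M0 hA] /closure_sq hx; apply: sq_arbitrarily_small => e e0.
have c0 : 0 < 2 * M ^+ 2 + 2 * lam ^+ 2.
  by apply: ltr_wpDr; [rewrite mulr_ge0 ?sqr_ge0|rewrite mulr_gt0 ?exprn_gt0].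
have [y [ky _ _] xy] := hx _ (divr_gt0 e0 c0).
rewrite -[x](subrK y) shift_opD ky addr0.
have := sqD_le (A0 (x - y)) (- (lam%:C *: (x - y))); rewrite sqN sqZ.
move: xy; rewrite ltr_pdivlMr//; have := hA (x - y); rewrite /shift_op.
move: (sq (x - y)) (sq (A0 (x - y))) (sq (_ - _)) => a b c; lra.
Qed.

End kernel_core_swap.

Definition rank_one (R : realType) (H0 H1 : hilbertType R) (a : H0) (b : H1)
  (x : H0) : H1 := inner x a *: b.

Section rank_one_linear.
Context (R : realType) (H0 H1 : hilbertType R) (a : H0) (b : H1).

Lemma rank_one_linear : linear (rank_one a b).
Proof. by move=> c x y; rewrite /rank_one linearPl /= scalerDl scalerA. Qed.

HB.instance Definition _ := GRing.isLinear.Build R[i] H0 H1 *:%R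
  (rank_one a b) rank_one_linear.

End rank_one_linear.

(** * Block operators and isotropic vectors *)

Section block_geometry.
Context (R : realType) (H H0 H1 : hilbertType R).
Context (J0 : {linear H0 -> H}) (J1 : {linear H1 -> H}).
Hypothesis dec : orthogonal_decomposition J0 J1.

Lemma ip_block x y x' y' :
  ip (J0 x + J1 y) (J0 x' + J1 y') = ip x x' + ip y y'.
Proof.
rewrite !(ipDl, ipDr).
have o a b : ip (J0 a) (J1 b) = 0 by rewrite /ip (orthogonal01 dec).
have i0 a b : ip (J0 a) (J0 b) = ip a b by rewrite /ip (isometry0 dec).
have i1 a b : ip (J1 a) (J1 b) = ip a b by rewrite /ip (isometry1 dec).
by rewrite i0 i1 o (ipC (J1 y)) o addr0 add0r.
Qed.

Lemma sq_block x y : sq (J0 x + J1 y) = sq x + sq y.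
Proof. exact: ip_block. Qed.

Lemma blockD x y x' y' :
  (J0 x + J1 y) + (J0 x' + J1 y') = J0 (x + x') + J1 (y + y').
Proof. by rewrite !linearD addrACA. Qed.

Lemma blockZ c x y : c *: (J0 x + J1 y) = J0 (c *: x) + J1 (c *: y).
Proof. by rewrite scalerDr !linearZ. Qed.

Lemma blockB x y x' y' :
  (J0 x + J1 y) - (J0 x' + J1 y') = J0 (x - x') + J1 (y - y').
Proof. by rewrite !linearB opprD addrACA. Qed.

Lemma blockN x y : - (J0 x + J1 y) = J0 (- x) + J1 (- y).
Proof. by rewrite !linearN opprD. Qed.

Lemma block0 y : J1 y = J0 0 + J1 y.
Proof. by rewrite linear0 add0r. Qed.

Lemma block1 x : J0 x = J0 x + J1 0.
Proof. by rewrite linear0 addr0. Qed.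

Lemma block_inj x y x' y' :
  J0 x + J1 y = J0 x' + J1 y' -> x = x' /\ y = y'.
Proof.
move=> /eqP; rewrite -subr_eq0 blockB => /eqP h.
have : sq (x - x') + sq (y - y') = 0 by rewrite -sq_block h sq0.
have := sq_ge0 (x - x'); have := sq_ge0 (y - y') => s1 s0 s01.
by split; apply/eqP; rewrite -subr_eq0; apply/eqP/sq_le0; lra.
Qed.

Definition comp0 h := projT1 (cid (span01 dec h)).
Definition comp1 h := projT1 (cid (projT2 (cid (span01 dec h)))).

Lemma compE h : h = J0 (comp0 h) + J1 (comp1 h).
Proof. exact: projT2 (cid (projT2 (cid (span01 dec h)))). Qed.

Lemma comp_block x y : comp0 (J0 x + J1 y) = x /\ comp1 (J0 x + J1 y) = y.
Proof. by apply: block_inj; rewrite -compE. Qed.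

(** The indefinite form of the symmetry diag(1, -1). *)
Definition indefinite (u v : H) : R :=
  ip (comp0 u) (comp0 v) - ip (comp1 u) (comp1 v).

Lemma indefinite_block x y x' y' :
  indefinite (J0 x + J1 y) (J0 x' + J1 y') = ip x x' - ip y y'.
Proof.
rewrite /indefinite; have [-> ->] := comp_block x y.
by have [-> ->] := comp_block x' y'.
Qed.

Lemma indefiniteB u v : indefinite (u - v) (u - v) =
  indefinite u u - 2 * indefinite v u + indefinite v v.
Proof.
rewrite [u]compE [v]compE blockB !indefinite_block !ipE.
rewrite (ipC (comp0 u) (comp0 v)) (ipC (comp1 u) (comp1 v)); ring.
Qed.

Lemma indefiniteNl u v : indefinite (- u) v = - indefinite u v.
Proof. by rewrite [u]compE [v]compE blockN !indefinite_block !ipE opprB addrC opprK. Qed.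

Lemma indefinite_le u : `|indefinite u u| <= sq u.
Proof.
rewrite [u]compE indefinite_block sq_block -/(sq _) -/(sq _) ler_norml.
have := sq_ge0 (comp0 u); have := sq_ge0 (comp1 u); lra.
Qed.

Variables (A0 : {linear H0 -> H0}) (A1 : {linear H1 -> H1}).
Variables (V : {linear H1 -> H0}) (Vs : {linear H0 -> H1}).
Variables (lam e : R) (B : {linear H -> H}).
Hypothesis sA0 : symmetric_op A0.
Hypothesis sA1 : symmetric_op A1.
Hypothesis VVs : forall x y, ip (V x) y = ip x (Vs y).
Hypothesis A0_le : forall x, ip (A0 x) x <= lam * sq x.
Hypothesis A1_ge : forall x, lam * sq x <= ip (A1 x) x.
Hypothesis B_block : is_block_operator J0 J1 A0 V Vs A1 B.
Notation S0 := (shift_op A0 lam%:C).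
Notation S1 := (shift_op A1 lam%:C).
Notation W := (shift_op B lam%:C).
Notation T := (scaled_shift B lam e).

Lemma shift_block x y :
  W (J0 x + J1 y) = J0 (S0 x + V y) + J1 (Vs x + S1 y).
Proof.
rewrite {1}/shift_op B_block blockZ blockB /shift_op.
by rewrite addrAC !addrA.
Qed.

Lemma S0_form_le0 x : ip (S0 x) x <= 0.
Proof. by rewrite /shift_op ipBl ipZl subr_le0; exact: A0_le. Qed.

Lemma S1_form_ge0 x : 0 <= ip (S1 x) x.
Proof. by rewrite /shift_op ipBl ipZl subr_ge0; exact: A1_ge. Qed.

(** The two forms have opposite signs, so they can only agree at zero. *)
Lemma forms_vanish x y : ip (S0 x) x = ip (S1 y) y -> S0 x = 0 /\ S1 y = 0.
Proof.
have := S0_form_le0 x; have := S1_form_ge0 y => h1 h0 h01.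
by split; [apply: shift_form_max|apply: shift_form_min] => //; lra.
Qed.

Lemma VsV x y : ip (Vs x) y = ip x (V y).
Proof. by rewrite ipC -VVs ipC. Qed.

Lemma block_sym : symmetric_op B.
Proof.
move=> u v; rewrite [u]compE [v]compE !B_block !ip_block !ipE sA0 sA1 VVs VsV.
ring.
Qed.

(** The cross terms of the two component equations cancel when these are paired with x
and y, which leaves two forms of opposite signs. *)
Lemma kernel_block x y : W (J0 x + J1 y) = 0 ->
  [/\ S0 x = 0, S1 y = 0, V y = 0 & Vs x = 0].
Proof.
rewrite shift_block -[RHS]addr0 -{1}(linear0 J0) -(linear0 J1) => /block_inj[k0 k1].
have [S0x S1y] : S0 x = 0 /\ S1 y = 0.
  apply: forms_vanish.
  have := congr1 (fun z => ip z x) k0; have := congr1 (fun z => ip z y) k1.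
  by rewrite /= !ipDl !ip0l VsV (ipC x); lra.
by split => //; [move: k0; rewrite S0x add0r|move: k1; rewrite S1y addr0].
Qed.

Lemma kernel_blockP x y : S0 x = 0 -> S1 y = 0 -> V y = 0 -> Vs x = 0 ->
  W (J0 x + J1 y) = 0.
Proof. by rewrite shift_block => -> -> -> ->; rewrite !addr0 !linear0 addr0. Qed.

Section invariant_subspace.
Variable L : set H.
Hypothesis hL : closed_subspace L.
Hypothesis WL : forall h, L h -> L (W h).

Lemma scaled_shift_invariant h : L h -> L (T h).
Proof. by move=> /WL; apply: (subspaceZ hL). Qed.

(** The vectors of [L] that are orthogonal to all of [L] for the indefinite form. *)
Definition isotropic x y := L (J0 x + J1 y) /\
  forall x' y', L (J0 x' + J1 y') -> ip x x' = ip y y'.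

(** Cauchy--Schwarz for a semidefinite form; the sign [s] covers graphs and their
orthogonal complements at once. *)
Lemma isotropic_of_semidefinite (s : R) x y : s != 0 ->
  (forall x' y', L (J0 x' + J1 y') -> 0 <= s * (sq x' - sq y')) ->
  L (J0 x + J1 y) -> sq x = sq y -> isotropic x y.
Proof.
move=> s0 pos Lxy xy; split=> // x' y' Lxy'.
have : (s * (ip x x' - ip y y')) ^+ 2 <= 0 * (s * (sq x' - sq y')).
  apply: discriminant_le => [|t]; first exact: pos.
  have := pos (x + t%:C *: x') (y + t%:C *: y').
  rewrite -blockD -blockZ => /(_ (subspaceD hL Lxy (subspaceZ hL _ Lxy'))).
  rewrite !sqD !sqZ !ipZr xy => h; apply: le_trans h _; rewrite le_eqVlt.
  by apply/orP; left; apply/eqP; ring.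
rewrite mul0r => h; have /eqP : (s * (ip x x' - ip y y')) ^+ 2 = 0.
  by apply/eqP; rewrite eq_le h sqr_ge0.
by rewrite sqrf_eq0 mulf_eq0 (negbTE s0) subr_eq0 => /eqP.
Qed.

(** On an isotropic vector the derivative of the form vanishes; its two diagonal
contributions have opposite signs, so both are zero and only the off-diagonal part of
the block operator acts, mapping isotropic vectors to isotropic vectors. *)
Lemma isotropic_step x y : isotropic x y ->
  [/\ S0 x = 0, S1 y = 0 & isotropic (V y) (Vs x)].
Proof.
move=> [Lxy iso].
have [S0x S1y] : S0 x = 0 /\ S1 y = 0.
  apply: forms_vanish.
  have := WL Lxy; rewrite shift_block => /iso.
  rewrite (ipDr (S0 x)) (ipDr (Vs x)) -VsV (ipC y (Vs x)) (ipC x) (ipC y (S1 y)); lra.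
split=> //; split.
  by have := WL Lxy; rewrite shift_block S0x S1y add0r addr0.
move=> x' y' /WL; rewrite shift_block => /iso.
rewrite (ipDr (S0 x')) (ipDr (Vs x')) -(shift_op_sym _ sA0)
  -(shift_op_sym _ sA1) S0x S1y !ip0l add0r addr0.
by rewrite VVs VsV.
Qed.

Lemma isotropic_iter n x y : isotropic x y ->
  isotropic (iter n (V \o Vs) x) (iter n (Vs \o V) y).
Proof.
move=> xy; elim: n => //= n /isotropic_step[_ _].
by move=> /isotropic_step[].
Qed.

Lemma isotropic_core x y : isotropic x y ->
  kernel_core A0 A1 V Vs lam (V y) /\ kernel_core A1 A0 Vs V lam (Vs x).
Proof.
move=> /isotropic_step[S0x S1y xy].
split; split; [|by exists y|move=> n| |by exists x|move=> n].
- by have [] := isotropic_step xy.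
- have [? ? /isotropic_step[? ? _]] := isotropic_step (isotropic_iter n xy).
  by [].
- by have [] := isotropic_step xy.
- have [? ? /isotropic_step[? ? _]] := isotropic_step (isotropic_iter n xy).
  by [].
Qed.

Hypothesis e0 : 0 < e.

(** The off-diagonal blocks cancel in the real part, so only the two diagonal forms
contribute, both with a nonpositive sign. *)
Lemma derivative_le0 h : indefinite (T h) h <= 0.
Proof.
rewrite [h]compE /scaled_shift shift_block blockZ indefinite_block.
rewrite (ipZl e (_ + _) (comp0 h)) (ipZl e (_ + _) (comp1 h)).
rewrite (ipDl (S0 _)) (ipDl (Vs _)) -mulrBr pmulr_rle0// VsV (ipC (V _)).
have := S0_form_le0 (comp0 h); have := S1_form_ge0 (comp1 h); lra.
Qed.

Lemma decays_isotropic_pos x y :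
  (forall x' y', L (J0 x' + J1 y') -> sq y' <= sq x') ->
  L (J0 x + J1 y) -> decays T (J0 x + J1 y) -> isotropic x y.
Proof.
move=> pos Lxy hd.
apply: (isotropic_of_semidefinite (oner_neq0 _)) => //.
  by move=> x' y' /pos; rewrite mul1r subr_ge0.
have := @decays_form_eq0 _ _ T L indefinite _ hL
  scaled_shift_invariant indefiniteB _ _ _ Lxy hd.
rewrite indefinite_block => h; apply/eqP; rewrite -subr_eq0 h// => {h} [u|u Lu|u _].
- exact: le_trans (ler_norm _) (indefinite_le u).
- rewrite [u]compE indefinite_block subr_ge0; apply: pos.
  by rewrite -compE.
- exact: derivative_le0.
Qed.

Lemma decays_isotropic_neg x y :
  (forall x' y', L (J0 x' + J1 y') -> sq x' <= sq y') ->
  L (J0 x + J1 y) -> decays (\- T) (J0 x + J1 y) -> isotropic x y.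
Proof.
move=> neg Lxy hd.
have n1 : (-1 : R) != 0 by rewrite oppr_eq0 oner_neq0.
apply: (isotropic_of_semidefinite n1) => //.
  by move=> x' y' /neg; rewrite mulN1r oppr_ge0 subr_le0.
have NTL h : L h -> L ((\- T) h) by move=> /scaled_shift_invariant; exact: subspaceN.
have := @decays_form_eq0 _ _ (\- T) L (fun u v => - indefinite u v) _
  hL NTL _ _ _ _ Lxy hd.
rewrite indefinite_block opprB => h; apply/eqP; rewrite eq_sym -subr_eq0 h//
  => {h} [u v|u|u Lu|u _].
- by rewrite indefiniteB; ring.
- by apply: le_trans (ler_norm _) _; rewrite normrN; exact: indefinite_le.
- rewrite [u]compE indefinite_block opprB subr_ge0; apply: neg.
  by rewrite -compE.
by rewrite /= indefiniteNl opprK; exact: derivative_le0.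
Qed.

End invariant_subspace.

(** * Graphs of contractive solutions *)

Lemma scaled_shift_eq0 h : 0 < e -> T h = 0 <-> W h = 0.
Proof.
move=> e0; rewrite /scaled_shift; split=> [/eqP|->]; last by rewrite scaler0.
rewrite scaler_eq0 => /orP[/eqP[ez]|/eqP//].
by move: e0; rewrite ez ltxx.
Qed.

(** For h = l + l' in the kernel, Tl and Tl' are orthogonal and opposite. *)
Lemma kernel_split M l l' : closed_subspace M -> (forall h, M h -> M (W h)) ->
  M l -> orthogonal M l' -> T (l + l') = 0 -> T l = 0 /\ T l' = 0.
Proof.
move=> hM WM Ml Ml' Tll.
have sT : symmetric_op T := scaled_shift_sym lam e block_sym.
have TE : T l = - T l' by apply/eqP; rewrite -addr_eq0 -(linearD T) /= Tll.
have Tl : T l = 0.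
  apply: sq_eq0; rewrite /sq {2}TE ipNr ipC.
  rewrite (orthogonal_invariant sT (scaled_shift_invariant hM WM) Ml') ?oppr0//.
  exact: scaled_shift_invariant.
by move/eqP: TE; rewrite Tl eq_sym oppr_eq0 => /eqP.
Qed.

Section contractive_graph.
Variable Y : {linear H0 -> H1}.
Hypothesis hY : contractive_solution A0 A1 V Vs Y.
Notation L := (graph J0 J1 Y).

Lemma graph_block x y : L (J0 x + J1 y) <-> y = Y x.
Proof. by split=> [[z _ /block_inj[<- <-]]//|->]; exists x. Qed.

Lemma solution_sq_le x : sq (Y x) <= sq x.
Proof. by rewrite -norm_le_sq; case: hY. Qed.

Lemma graph_sq_le x y : L (J0 x + J1 y) -> sq y <= sq x.
Proof. by move=> /graph_block->; exact: solution_sq_le. Qed.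

Lemma graph_closed_subspace : closed_subspace L.
Proof.
split.
- by exists 0; rewrite ?linear0 ?addr0.
- move=> u v; rewrite [u]compE [v]compE => /graph_block hu /graph_block hv.
  by rewrite blockD; apply/graph_block; rewrite hu hv linearD.
- move=> c u; rewrite [u]compE => /graph_block hu.
  by rewrite blockZ; apply/graph_block; rewrite hu linearZ.
move=> h hh; rewrite [h]compE; apply/graph_block/eqP; rewrite -subr_eq0; apply/eqP.
apply: sq_arbitrarily_small => d d0.
have [v] := hh (d / 4) ltac:(by rewrite divr_gt0).
rewrite [v]compE => /graph_block hv.
rewrite {1}[h]compE blockB sq_block hv.
set x := comp0 h; set y := comp1 h; set z := comp0 v => hd.
have -> : y - Y x = (y - Y z) - Y (x - z) by rewrite linearB opprB addrA subrK.
have := sqD_le (y - Y z) (- Y (x - z)); rewrite sqN.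
have := solution_sq_le (x - z); have := sq_ge0 (x - z); move: hd.
by move: (sq (y - Y z)) (sq (x - z)) (sq (Y (x - z))) => *; lra.
Qed.

(** The Riccati equation says exactly that the graph is invariant. *)
Lemma graph_invariant h : L h -> L (W h).
Proof.
rewrite [h]compE => /graph_block ->; rewrite shift_block; apply/graph_block.
set x := comp0 h; have [_ /(_ x)] := hY.
rewrite /shift_op linearD linearB [Y (lam%:C *: x)]linearZ /= addrC => /eqP.
by rewrite addr_eq0 => /eqP->; rewrite !opprB -addrA subrKA addrC.
Qed.

Notation L' := (orthogonal L).

(** A vector (x, y) orthogonal to (x, Yx) satisfies |x|^2 = -<y, Yx> <= |y| |x|. *)
Lemma orthogonal_graph_sq_le x y : L' (J0 x + J1 y) -> sq x <= sq y.
Proof.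
have Lx : L (J0 x + J1 (Y x)) by exists x.
move=> /(_ _ Lx); rewrite ip_block => h.
have := ip_sqr_le y (Y x).
have -> : ip y (Y x) = - sq x by rewrite -[sq x]/(ip x x); lra.
rewrite sqrrN => h1.
have h2 : sq x ^+ 2 <= sq y * sq x.
  by apply: le_trans h1 _; rewrite ler_wpM2l ?sq_ge0// solution_sq_le.
have := sq_ge0 x; rewrite le_eqVlt => /orP[/eqP<-|x0]; first exact: sq_ge0.
by rewrite -(ler_pM2r x0) -expr2.
Qed.

Lemma orthogonal_graph_invariant h : L' h -> L' (W h).
Proof.
apply: orthogonal_invariant; last exact: graph_invariant.
exact: shift_op_sym block_sym.
Qed.

Hypothesis core0 : forall x, kernel_core A0 A1 V Vs lam x -> x = 0.
Hypothesis core1 : forall x, kernel_core A1 A0 Vs V lam x -> x = 0.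

(** The off-diagonal images of an isotropic vector lie in the two cores, so they vanish
once the cores are trivial. *)
Lemma isotropic_kernel M x y : closed_subspace M ->
  (forall h, M h -> M (W h)) -> isotropic M x y -> W (J0 x + J1 y) = 0.
Proof.
move=> hM WM iso; have [S0x S1y _] := isotropic_step WM iso.
have [/core0 Vy /core1 Vx] := isotropic_core WM iso.
exact: kernel_blockP.
Qed.

(** A vector where [Y] is isometric gives an isotropic vector of the graph. *)
Lemma isometric_kernel x : sq (Y x) = sq x ->
  [/\ S0 x = 0, S1 (Y x) = 0, V (Y x) = 0 & Vs x = 0].
Proof.
move=> Yx; apply: kernel_block; apply: (isotropic_kernel graph_closed_subspace).
  exact: graph_invariant.
apply: (isotropic_of_semidefinite graph_closed_subspace (oner_neq0 _)) => //.
- by move=> x' y' /graph_sq_le; rewrite mul1r subr_ge0.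
- exact/graph_block.
Qed.

Hypothesis e0 : 0 < e.
Hypothesis splitT : sign_splitting T.

Let sT : symmetric_op T := scaled_shift_sym lam e block_sym.
Let sNT : symmetric_op (\- T).
Proof. by move=> x y; rewrite /= ipNl ipNr sT. Qed.
Let TLg h : L h -> L (T h) :=
  scaled_shift_invariant graph_closed_subspace graph_invariant (h := h).
Let NTLg h : L h -> L ((\- T) h).
Proof. by move=> /TLg; apply: subspaceN graph_closed_subspace. Qed.

Lemma graph_pos_trivial h : L h -> decays T h -> h = 0.
Proof.
rewrite [h]compE => Lh hd.
have iso : isotropic L (comp0 h) (comp1 h).
  apply: (decays_isotropic_pos graph_closed_subspace graph_invariant e0) => //.
  exact: graph_sq_le.
have Wh := isotropic_kernel graph_closed_subspace graph_invariant iso.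
apply: sq_eq0; apply: (sign_orth_pos splitT) => //.
by apply/scaled_shift_eq0.
Qed.

Lemma orthogonal_graph_neg_trivial h : L' h -> decays (\- T) h -> h = 0.
Proof.
have hL' := orthogonal_closed_subspace graph_closed_subspace.
rewrite [h]compE => Lh hd.
have iso : isotropic L' (comp0 h) (comp1 h).
  apply: (decays_isotropic_neg hL' orthogonal_graph_invariant e0) => //.
  exact: orthogonal_graph_sq_le.
have Wh := isotropic_kernel hL' orthogonal_graph_invariant iso.
apply: sq_eq0; apply: (sign_orth_neg splitT) => //.
by apply/scaled_shift_eq0.
Qed.

(** The component orthogonal to the graph still decays for [\- T], so it is zero. *)
Lemma graph_of_neg h : decays (\- T) h -> L h.
Proof.
have [l [l' [Ll Ll' ->]]] := subspace_decomp h graph_closed_subspace => hd.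
have [_ hl'] := decays_split sNT graph_closed_subspace NTLg Ll Ll' hd.
by rewrite (orthogonal_graph_neg_trivial Ll' hl') addr0.
Qed.

(** The positive part is orthogonal to the graph, because its component in the graph
decays and so vanishes; but its inner product with the given vector of the graph is its
squared norm. *)
Lemma graph_pos_part a b c : decays (\- T) a -> T b = 0 -> decays T c ->
  L (a + b + c) -> c = 0.
Proof.
move=> ha hb hc Labc.
have [l [l' [Ll Ll' cE]]] := subspace_decomp c graph_closed_subspace.
have [hl hl'] : decays T l /\ decays T l'.
  by apply: (decays_split sT graph_closed_subspace TLg) => //; rewrite -cE.
have Lc : L' c by rewrite cE (graph_pos_trivial Ll hl) add0r.
have := Lc _ Labc.
rewrite 2!ipDr ipC (sign_orth splitT ha hc) ipC (sign_orth_pos splitT hb hc).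
by rewrite !add0r => /sq_eq0.
Qed.

(** The kernel component of a vector of the graph is (x, Yx) with x in the first
kernel, so it is zero. *)
Lemma graph_eq_neg h : (forall x, S0 x = 0 -> Vs x = 0 -> x = 0) ->
  L h <-> decays (\- T) h.
Proof.
move=> N0; split; last exact: graph_of_neg.
have [a [b [c [ha hb hc ->]]]] := sign_sum splitT h => Lh.
have c0 := graph_pos_part ha hb hc Lh; move: Lh; rewrite c0 addr0 => Lab.
have : L b.
  rewrite -[b](addKr a) addrC; apply: (subspaceB graph_closed_subspace) Lab _.
  exact: graph_of_neg.
move: hb => /(scaled_shift_eq0 _ e0); rewrite [b]compE => Wb /graph_block.
have [S0b _ _ Vb] := kernel_block Wb.
by rewrite (N0 _ S0b Vb) => ->; rewrite !linear0 !addr0.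
Qed.

(** The part of a kernel vector orthogonal to the graph has second component in the
second kernel, hence zero, and then its first component is zero as well. *)
Lemma graph_eq_nonpos h : (forall y, S1 y = 0 -> V y = 0 -> y = 0) ->
  L h <-> exists a b, [/\ decays (\- T) a, T b = 0 & h = a + b].
Proof.
move=> N1; split=> [|[a [b [ha hb ->]]]].
  have [a [b [c [ha hb hc ->]]]] := sign_sum splitT h => Lh.
  by exists a, b; rewrite (graph_pos_part ha hb hc Lh) addr0.
apply: (subspaceD graph_closed_subspace); first exact: graph_of_neg.
have [l [l' [Ll Ll' bE]]] := subspace_decomp b graph_closed_subspace.
suff -> : b = l by [].
have [_ Tl'] : T l = 0 /\ T l' = 0.
  apply: (kernel_split graph_closed_subspace graph_invariant) => //.
  by rewrite -bE.
move: Tl' Ll' bE => /(scaled_shift_eq0 _ e0); rewrite [l']compE => Wl' Ll'.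
have [_ S1y Vy _] := kernel_block Wl'.
have y0 := N1 _ S1y Vy.
have := orthogonal_graph_sq_le Ll'; rewrite y0 sq0 => /sq_le0 x0.
by rewrite x0 !linear0 !addr0.
Qed.

End contractive_graph.

(** Both descriptions of the graph are independent of the solution. *)
Lemma solution_unique (Y Z : {linear H0 -> H1}) :
  0 < e -> sign_splitting T ->
  (forall x, kernel_core A0 A1 V Vs lam x -> x = 0) ->
  (forall x, kernel_core A1 A0 Vs V lam x -> x = 0) ->
  (forall x, S0 x = 0 -> Vs x = 0 -> x = 0) \/
  (forall y, S1 y = 0 -> V y = 0 -> y = 0) ->
  contractive_solution A0 A1 V Vs Y -> contractive_solution A0 A1 V Vs Z ->
  Y =1 Z.
Proof.
move=> e0 splitT c0 c1 N hY hZ x.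
apply/(graph_block Z); have : graph J0 J1 Y (J0 x + J1 (Y x)) by exists x.
case: N => N.
  by move/(graph_eq_neg hY c0 c1 e0 splitT _ N)/(graph_eq_neg hZ c0 c1 e0 splitT _ N).
by move/(graph_eq_nonpos hY c0 c1 e0 splitT _ N)
  /(graph_eq_nonpos hZ c0 c1 e0 splitT _ N).
Qed.

(** * Additional solutions when a condition fails *)

Lemma decays0 : decays (\- T) 0.
Proof. by move=> d d0; exists 0%N; rewrite /= sq0. Qed.

Section another_solution.
Variable X : {linear H0 -> H1}.
Hypothesis hX : contractive_solution A0 A1 V Vs X.
Hypothesis e0 : 0 < e.
Hypothesis splitT : sign_splitting T.
Hypothesis graphX : forall h, graph J0 J1 X h <->
  exists a n, [/\ decays (\- T) a, T (J0 n) = 0 & h = a + J0 n].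

(** The kernel vector [J0 x] belongs to the second summand of the graph. *)
Lemma solution_on_kernel0 x : S0 x = 0 -> Vs x = 0 -> X x = 0.
Proof.
move=> S0x Vx; apply/esym/(graph_block X); rewrite linear0 addr0; apply/graphX.
exists 0, x; split; [exact: decays0| |by rewrite add0r].
apply/scaled_shift_eq0 => //; rewrite block1.
by apply: kernel_blockP => //; rewrite ?shift_op0 ?linear0.
Qed.

Lemma solution_orth_kernel1 x y : S1 y = 0 -> V y = 0 -> ip (X x) y = 0.
Proof.
move=> S1y Vy; have Ty : T (J1 y) = 0.
  apply/scaled_shift_eq0 => //; rewrite block0.
  by apply: kernel_blockP => //; rewrite ?shift_op0 ?linear0.
have /graphX[a [n [ha _ hE]]] : graph J0 J1 X (J0 x + J1 (X x)) by exists x.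
have := ip_block x (X x) 0 y; rewrite linear0 add0r hE ipDl.
rewrite (sign_orth_neg splitT ha Ty) ip0r !add0r => <-.
by rewrite /ip (orthogonal01 dec).
Qed.

(** A rank-one map between the two kernels is orthogonal to [X] on both sides and
contributes to the Riccati equation only two terms with the factor [lam], which
cancel. *)
Lemma rank_one_solution a b : self_adjoint A0 -> is_adjoint V Vs ->
  sq a = 1 -> S0 a = 0 -> Vs a = 0 -> sq b = 1 -> S1 b = 0 -> V b = 0 ->
  exists2 Y : {linear H0 -> H1}, contractive_solution A0 A1 V Vs Y & ~ (Y =1 X).
Proof.
move=> A0_sa V_adj a1 S0a Va b1 S1b Vb.
have A0a : A0 a = lam%:C *: a by apply/eqP; rewrite -subr_eq0; apply/eqP.
have A1b : A1 b = lam%:C *: b by apply/eqP; rewrite -subr_eq0; apply/eqP.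
exists (X \+ rank_one a b).
  split=> [x|x]; rewrite /= /rank_one.
    rewrite norm_le_sq; set c := inner x a.
    have XE : X x = X (x - c *: a).
      by rewrite linearB linearZ /= (solution_on_kernel0 S0a Va) scaler0 subr0.
    have o1 : ip (X x) (c *: b) = 0.
      by rewrite ipC ip_conj -linearZ ipC solution_orth_kernel1.
    have o0 : ip (x - c *: a) (c *: a) = 0.
      rewrite /ip linearBl /= !linearZr_LR /= linearZl_LR /= -/c.
      by rewrite inner_sq a1 mulr1 subrr.
    rewrite sqD o1 XE sqZ_complex b1.
    rewrite -{2}[x](subrK (c *: a)) sqD o0 sqZ_complex a1.
    have := solution_sq_le hX (x - c *: a); lra.
  have [_ /(_ x)] := hX.
  have -> : A1 (X x + inner x a *: b) = A1 (X x) + (lam%:C * inner x a) *: b.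
    by rewrite linearD linearZ /= A1b scalerA mulrC.
  have -> : inner (A0 x) a = lam%:C * inner x a.
    by rewrite A0_sa A0a linearZr_LR /= conj_real.
  have -> : V (X x + inner x a *: b) = V (X x).
    by rewrite linearD linearZ /= Vb scaler0 addr0.
  have -> : inner (V (X x)) a = 0 by rewrite V_adj Va linear0r.
  by rewrite scale0r addr0 opprD addrACA subrr addr0.
move=> /(_ a) /=; rewrite /rank_one inner_sq a1 scale1r => /eqP.
rewrite -subr_eq0 addrAC subrr add0r => /eqP b0.
by move: b1; rewrite b0 sq0 => /esym/eqP; rewrite oner_eq0.
Qed.

Hypothesis bA0 : sq_bounded A0.
Hypothesis bA1 : sq_bounded A1.
Hypothesis bV : sq_bounded V.
Hypothesis bVs : sq_bounded Vs.
Notation K0 := (invariant_kernel A0 A1 V Vs lam).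
Notation K1 := (invariant_kernel A1 A0 Vs V lam).
Notation K := [set h | K0 (comp0 h) /\ K1 (comp1 h)].

Let hK0 : closed_subspace K0 := kernel_core_closure A0 A1 V Vs lam.
Let hK1 : closed_subspace K1 := kernel_core_closure A1 A0 Vs V lam.

Lemma core_sum_block x y : K (J0 x + J1 y) <-> K0 x /\ K1 y.
Proof. by rewrite /=; have [-> ->] := comp_block x y. Qed.

Lemma core_sum_closed : closed_subspace K.
Proof.
split.
- have -> : (0 : H) = J0 0 + J1 0 by rewrite !linear0 addr0.
  by apply/core_sum_block; split; [apply: (subspace0 hK0)|apply: (subspace0 hK1)].
- move=> u v; rewrite [u]compE [v]compE => /core_sum_block[u0 u1]
    /core_sum_block[v0 v1].
  by rewrite blockD; apply/core_sum_block; split;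
    [apply: (subspaceD hK0)|apply: (subspaceD hK1)].
- move=> c u; rewrite [u]compE => /core_sum_block[u0 u1].
  by rewrite blockZ; apply/core_sum_block; split;
    [apply: (subspaceZ hK0)|apply: (subspaceZ hK1)].
move=> h hh; split; [apply: (subspace_closed hK0)|apply: (subspace_closed hK1)];
  move=> d /hh[v [v0 v1]]; rewrite {1}[h]compE {1}[v]compE blockB sq_block => hd.
- by exists (comp0 v) => //; apply: le_lt_trans hd; rewrite lerDl sq_ge0.
- by exists (comp1 v) => //; apply: le_lt_trans hd; rewrite lerDr sq_ge0.
Qed.

Lemma core_sum_invariant h : K h -> K (W h).
Proof.
rewrite [h]compE => /core_sum_block[k0 k1]; rewrite shift_block; apply/core_sum_block.
rewrite (core_closure_shift bA0 k0) (core_closure_shift bA1 k1) add0r addr0.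
by split; [exact: (core_closure_map bV k1)|exact: (core_closure_map bVs k0)].
Qed.

Lemma core_sum_orth x y : orthogonal K0 x -> orthogonal K1 y ->
  orthogonal K (J0 x + J1 y).
Proof.
move=> hx hy h; rewrite [h]compE => /core_sum_block[k0 k1].
by rewrite ip_block hx// hy// addr0.
Qed.

(** The summand of the graph in the negative spectral subspace is described by decay,
hence reduced by [K]; the summand in the kernel lies in [H0], and is reduced because
[K] is a direct sum of subspaces of [H0] and [H1]. *)
Lemma graph_split l l' : K l -> orthogonal K l' -> graph J0 J1 X (l + l') ->
  graph J0 J1 X l.
Proof.
have hK := core_sum_closed; have WK := core_sum_invariant.
move=> Kl Kl' /graphX[a [n [ha hn hE]]].
have sNT : symmetric_op (\- T).
  by move=> x y; rewrite /= ipNl ipNr (scaled_shift_sym lam e block_sym).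
have NTK h : K h -> K ((\- T) h).
  by move=> Kh; exact: (subspaceN hK (scaled_shift_invariant hK WK Kh)).
have [p [p' [Kp Kp' aE]]] := subspace_decomp a hK.
have [q [q' [Kq Kq' nE]]] := subspace_decomp n hK0.
have [hp _] : decays (\- T) p /\ decays (\- T) p'.
  by apply: (decays_split sNT hK NTK) => //; rewrite -aE.
have KJq : K (J0 q).
  by rewrite block1; apply/core_sum_block; split => //; exact: (subspace0 hK1).
have KJq' : orthogonal K (J0 q').
  by rewrite block1; apply: core_sum_orth => // z _; rewrite ip0l.
have [Tq _] : T (J0 q) = 0 /\ T (J0 q') = 0.
  by apply: (kernel_split hK WK KJq KJq'); rewrite -(linearD J0) /= -nE.
apply/graphX; exists p, q; split => //.
apply/eqP; rewrite -subr_eq0; apply/eqP/sq_eq0.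
have E : l - (p + J0 q) = (p' + J0 q') - l'.
  have -> : l = (p + J0 q) + (p' + J0 q') - l'.
    by rewrite addrACA -(linearD J0) /= -nE -aE -hE addrK.
  by rewrite addrAC (addrC (p + _)) addrK.
rewrite /sq {1}E; have hK' := orthogonal_closed_subspace hK.
have /(_ (l - (p + J0 q))) : orthogonal K (p' + J0 q' - l').
  by apply: (subspaceB hK') => //; apply: (subspaceD hK').
by apply; apply: (subspaceB hK) => //; apply: (subspaceD hK).
Qed.

Lemma solution_core x : K0 x -> K1 (X x).
Proof.
have [b [b' [Kb Kb' XE]]] := subspace_decomp (X x) hK1 => Kx.
have : graph J0 J1 X ((J0 x + J1 b) + J1 b').
  by exists x; rewrite // -addrA -linearD -XE.
move/graph_split => /(_ _ _) /(graph_block X) <- //.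
- exact/core_sum_block.
- by rewrite block0; apply: core_sum_orth => // z _; rewrite ip0l.
Qed.

Lemma solution_core_orth x : orthogonal K0 x -> orthogonal K1 (X x).
Proof.
have [b [b' [Kb Kb' XE]]] := subspace_decomp (X x) hK1 => Kx.
have : graph J0 J1 X (J1 b + (J0 x + J1 b')).
  by exists x; rewrite // addrCA -linearD -XE.
have KJb : K (J1 b).
  by rewrite block0; apply/core_sum_block; split => //; exact: (subspace0 hK0).
move/(graph_split KJb (core_sum_orth Kx Kb')); rewrite block0 => /(graph_block X).
by rewrite linear0 => b0; rewrite XE b0 add0r.
Qed.

(** The new solution is [X] composed with the reflection that is -1 on the closure of
the core and 1 on its complement. On each of the two pieces every term of the Riccati
equation keeps its value or cancels, since the quadratic term changes sign twice. *)
Lemma reflected_solution : (exists2 x, kernel_core A0 A1 V Vs lam x & x != 0) ->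
  exists2 Y : {linear H0 -> H1}, contractive_solution A0 A1 V Vs Y & ~ (Y =1 X).
Proof.
move=> [x0 cx0 x0n].
have [P hP] := linear_projection hK0.
have shiftE (G : hilbertType R) (A : {linear G -> G}) z :
    shift_op A lam%:C z = 0 -> A z = lam%:C *: z.
  by move=> h; apply/eqP; rewrite -subr_eq0; apply/eqP.
pose Y : {linear H0 -> H1} := (X \- (X \o P)) \- (X \o P).
have Yin p : K0 p -> Y p = - X p.
  by move=> Kp; rewrite /Y /= (hP p).1// subrr add0r.
have Yorth q : orthogonal K0 q -> Y q = X q.
  by move=> Kq; rewrite /Y /= (hP q).2// linear0 !subr0.
clearbody Y; have [cX ricX] := hX.
exists Y; last first.
  move=> YX; apply/negP: x0n; rewrite negbK; apply/eqP.
  have Kx0 : K0 x0 by exact: subset_closure.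
  have Xx0 : X x0 = 0.
    have := Yin _ Kx0; rewrite YX => /eqP; rewrite -addr_eq0 => /eqP Xx.
    by apply: sq_eq0; have := congr1 (fun z => ip z (X x0)) Xx;
      rewrite ipDl ip0l /sq; lra.
  apply: (kernel_core_adjoint_inj VVs cx0).
  have := ricX x0; rewrite (shiftE _ _ _ (core_closure_shift bA0 Kx0))
    [X (_ *: _)]linearZ /=.
  by rewrite Xx0 scaler0 !linear0 !add0r.
split=> [x|x]; have [p [q [Kp Kq ->]]] := subspace_decomp x hK0.
  rewrite norm_le_sq linearD /= Yin// Yorth//.
  rewrite -linearN -linearD; apply: le_trans (solution_sq_le hX _) _.
  by rewrite !sqD sqN ipNl (ipC p) (Kq p Kp) oppr0.
have ric_in : A1 (Y p) - Y (A0 p) - Y (V (Y p)) + Vs p = 0.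
  have KXp := solution_core Kp.
  have KVXp := core_closure_map bV KXp.
  have A0p := shiftE _ _ _ (core_closure_shift bA0 Kp).
  have A1Xp := shiftE _ _ _ (core_closure_shift bA1 KXp).
  rewrite -[RHS](ricX p) A0p [Y (_ *: _)]linearZ [X (_ *: _)]linearZ /= Yin//.
  rewrite (linearN A1) (linearN V) (linearN Y) /= Yin// opprK A1Xp scalerN opprK.
  by rewrite addNr subrr.
have ric_orth : A1 (Y q) - Y (A0 q) - Y (V (Y q)) + Vs q = 0.
  rewrite -[RHS](ricX q) Yorth// (Yorth (A0 q)); last first.
    move=> z Kz; rewrite sA0 (shiftE _ _ _ (core_closure_shift bA0 Kz)).
    by rewrite ipZr Kq// mulr0.
  rewrite (Yorth (V (X q)))// => z Kz; rewrite VVs.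
  exact: (solution_core_orth Kq (core_closure_map bVs Kz)).
have := congr2 +%R ric_in ric_orth; rewrite addr0 => <-.
rewrite (linearD Y) (linearD A1) (linearD A0) (linearD V) (linearD Vs) /=.
rewrite !(linearD Y) !opprD [RHS]addrACA; congr (_ + _).
by rewrite [RHS]addrACA; congr (_ + _); rewrite [RHS]addrACA.
Qed.

End another_solution.

(** * The uniqueness criterion *)

Lemma block_sq_bounded : sq_bounded A0 -> sq_bounded A1 -> sq_bounded V ->
  sq_bounded Vs -> sq_bounded B.
Proof.
move=> [M0 p0 h0] [M1 p1 h1] [M2 p2 h2] [M3 p3 h3].
pose M := 2 * (M0 + M1 + M2 + M3).
exists M => [|h]; first by rewrite /M mulr_gt0// !addr_gt0.
rewrite [h]compE B_block !sq_block; set x := comp0 h; set y := comp1 h.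
have := sqD_le (A0 x) (V y); have := sqD_le (Vs x) (A1 y).
have := h0 x; have := h1 y; have := h2 y; have := h3 x.
have M2E : 2 * M0 ^+ 2 + 2 * M1 ^+ 2 + 2 * M2 ^+ 2 + 2 * M3 ^+ 2 <= M ^+ 2.
  rewrite /M; nra.
have sx := sq_ge0 x; have sy := sq_ge0 y.
have : (2 * M0 ^+ 2 + 2 * M3 ^+ 2) * sq x <= M ^+ 2 * sq x.
  by rewrite ler_wpM2r//; apply: le_trans M2E;
    have := sqr_ge0 M1; have := sqr_ge0 M2; lra.
have : (2 * M1 ^+ 2 + 2 * M2 ^+ 2) * sq y <= M ^+ 2 * sq y.
  by rewrite ler_wpM2r//; apply: le_trans M2E;
    have := sqr_ge0 M0; have := sqr_ge0 M3; lra.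
lra.
Qed.

End block_geometry.

Section existence_tools.
Context (R : realType).

(** Any [e] with e^2 (2 M^2 + 2 lam^2) <= 1 works. *)
Lemma exists_contraction (H : hilbertType R) (B : {linear H -> H}) (lam : R) :
  sq_bounded B ->
  exists2 e : R, 0 < e & forall x, sq (scaled_shift B lam e x) <= sq x.
Proof.
move=> [M M0 hM]; set K := 2 * M ^+ 2 + 2 * lam ^+ 2 + 1.
have K1 : 1 <= K by rewrite lerDr addr_ge0// mulr_ge0// sqr_ge0.
have K0 : 0 < K by apply: lt_le_trans K1.
exists K^-1 => [|x]; first by rewrite invr_gt0.
rewrite /scaled_shift sqZ /shift_op.
have h : sq (B x - lam%:C *: x) <= K * sq x.
  have := sqD_le (B x) (- (lam%:C *: x)); rewrite sqN sqZ.
  have := hM x; have := sq_ge0 x; rewrite /K; lra.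
have h1 : K * sq x <= K ^+ 2 * sq x.
  by rewrite ler_wpM2r ?sq_ge0// expr2 ler_peMl// ltW.
rewrite exprVn mulrC ler_pdivrMr ?exprn_gt0// [leRHS]mulrC.
exact: le_trans h h1.
Qed.

Lemma kernel_meet_trivial (H K : hilbertType R) (A : {linear H -> H})
    (W : {linear H -> K}) (c : R[i]) :
  ker (shift_op A c) `&` ker W = [set 0] <->
  forall x, shift_op A c x = 0 -> W x = 0 -> x = 0.
Proof.
split=> [h x Ax Wx|h].
  have : (ker (shift_op A c) `&` ker W) x by [].
  by rewrite h.
apply/seteqP; split=> [x [Ax Wx]|_ ->]; first exact: h.
by split; [exact: shift_op0|exact: linear0].
Qed.

Lemma kernel_meet_nontrivial (H K : hilbertType R) (A : {linear H -> H})
    (W : {linear H -> K}) (c : R[i]) :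
  ~ (forall x, shift_op A c x = 0 -> W x = 0 -> x = 0) ->
  exists x, [/\ sq x = 1, shift_op A c x = 0 & W x = 0].
Proof.
move=> /existsNP[x /not_implyP[Ax /not_implyP[Wx /eqP x0]]].
have [a _ a1] := normalize x0; exists (a%:C *: x); split => //.
  by rewrite shift_opZ Ax scaler0.
by rewrite linearZ /= Wx scaler0.
Qed.

End existence_tools.

Theorem theorem5p4 (R : realType) (H H0 H1 : hilbertType R)
    (J0 : {linear H0 -> H}) (J1 : {linear H1 -> H})
    (A0 : {linear H0 -> H0}) (A1 : {linear H1 -> H1})
    (V : {linear H1 -> H0}) (Vs : {linear H0 -> H1})
    (lam : R) (B : {linear H -> H}) (E : set R -> {linear H -> H})
    (X : {linear H0 -> H1})
    (sepH : separable H)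
    (decH : orthogonal_decomposition J0 J1)
    (A0_bounded : bounded_operator A0) (A0_sa : self_adjoint A0)
    (A1_bounded : bounded_operator A1) (A1_sa : self_adjoint A1)
    (V_bounded : bounded_operator V) (V_adj : is_adjoint V Vs)
    (spec0 : (ereal_sup (EFin @` real_spectrum A0) <= lam%:E)%E)
    (spec1 : (lam%:E <= ereal_inf (EFin @` real_spectrum A1))%E)
    (B_block : is_block_operator J0 J1 A0 V Vs A1 B)
    (E_spectral : is_spectral_measure B E)
    (X_sol : contractive_solution A0 A1 V Vs X)
    (X_graph : graph J0 J1 X = spectral_subspace J0 E lam) :
  let K0 := invariant_kernel A0 A1 V Vs lam in
  let K1 := invariant_kernel A1 A0 Vs V lam in
  let cond_i :=
    ker (shift_op A0 lam%:C) `&` ker Vs = [set 0] \/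
    ker (shift_op A1 lam%:C) `&` ker V = [set 0] in
  let cond_ii := K0 = [set 0] \/ K1 = [set 0] in
  [/\ (forall Y : {linear H0 -> H1},
         contractive_solution A0 A1 V Vs Y -> Y =1 X) <-> cond_i /\ cond_ii,
      K0 = [set 0] <-> K1 = [set 0]
    & cond_i /\ cond_ii -> strictly_contractive X].
Proof.
move=> K0 K1 cond_i cond_ii.
have sA0 := adjoint_ip A0_sa; have sA1 := adjoint_ip A1_sa.
have VVs := adjoint_ip V_adj.
have VsV x y : ip (Vs x) y = ip x (V y) by rewrite ipC -VVs ipC.
have A0_le x : ip (A0 x) x <= lam * sq x by apply: form_le_of_spectrum.
have A1_ge x : lam * sq x <= ip (A1 x) x by apply: form_ge_of_spectrum.
have bA0 := bounded_sq A0_bounded; have bA1 := bounded_sq A1_bounded.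
have bV := bounded_sq V_bounded; have bVs := adjoint_bounded_sq VVs bV.
have sB := block_sym decH sA0 sA1 VVs B_block.
have [e e0 cT] := exists_contraction lam (block_sq_bounded decH B_block bA0 bA1 bV bVs).
have splitT := spectral_sign_splitting E_spectral sB e0 cT.
have graphX h : graph J0 J1 X h <-> exists a n,
    [/\ decays (\- scaled_shift B lam e) a, scaled_shift B lam e (J0 n) = 0
      & h = a + J0 n].
  rewrite X_graph; split=> [[_ [u _ <-] [_ [[v _ <-] [n _ nv]] <-]]|].
    exists (E `]-oo, lam[%classic u), n; split; last by rewrite nv.
      apply/(spectral_negP E_spectral sB e0 cT).
      exact: (spectral_idem E_spectral (measurable_below lam)).
    apply/(spectral_kernelP lam E_spectral sB e0); rewrite nv.
    exact: (spectral_idem E_spectral (measurable_at lam)).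
  move=> [a [n [/(spectral_negP E_spectral sB e0 cT) ha]]].
  move=> /(spectral_kernelP lam E_spectral sB e0) hn ->.
  exists a; first by exists a.
  by exists (J0 n) => //; split; [exists (J0 n)|exists n].
have K01 : K0 = [set 0] <-> K1 = [set 0].
  by split=> /invariant_kernel_trivial h; apply/invariant_kernel_trivial;
    apply: kernel_core_trivial_swap h.
have core_trivial : cond_ii -> (forall x, kernel_core A0 A1 V Vs lam x -> x = 0) /\
    (forall x, kernel_core A1 A0 Vs V lam x -> x = 0).
  move=> h; split; apply/invariant_kernel_trivial; case: h => //; by move/K01.
have iP : cond_i <-> (forall x, shift_op A0 lam%:C x = 0 -> Vs x = 0 -> x = 0) \/
    (forall y, shift_op A1 lam%:C y = 0 -> V y = 0 -> y = 0).
  by split=> -[] /kernel_meet_trivial ?; by [left|right].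
split=> //.
- split=> [uniqX|[/iP ci /core_trivial[c0 c1]] Y hY]; last first.
    exact: (solution_unique decH sA0 sA1 VVs A0_le A1_ge B_block e0 splitT).
  split.
    apply/iP; apply: contrapT => /not_orP[/kernel_meet_nontrivial[a [a1 S0a Va]]].
    move=> /kernel_meet_nontrivial[b [b1 S1b Vb]].
    have [Y hY] := rank_one_solution decH B_block X_sol e0 splitT graphX
      A0_sa V_adj a1 S0a Va b1 S1b Vb.
    by apply; apply: uniqX.
  left; apply/invariant_kernel_trivial => x cx; apply: contrapT => /eqP x0.
  have [] := reflected_solution decH sA0 sA1 VVs B_block X_sol graphX bA0 bA1 bV bVs.
    by exists x.
  by move=> Y hY; apply; apply: uniqX.
move=> [/iP ci /core_trivial[c0 c1]] f f0.
rewrite lt_neqAle norm_le_sq (solution_sq_le X_sol) andbT; apply/eqP => Xf.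
have sXf : sq (X f) = sq f by rewrite !sqE Xf.
have [S0f S1f VXf Vf] :=
  isometric_kernel decH sA0 sA1 VVs A0_le A1_ge B_block X_sol c0 c1 sXf.
case/eqP: f0; case: ci => [N0|N1]; first exact: N0.
by apply: sq_eq0; rewrite -sXf (N1 _ S1f VXf) sq0.
Qed.
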